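(* Let $n>3$ be an integer, let $\mathcal{A}^H$ be the arrangement induced by $Q_n$ on a plane $H\subset\mathbb{P}^3$ that is not one of the planes of $Q_n$, and suppose that $\mathcal{A}^H$ is a light induced multinet without points of multiplicity $n$. Then the number of points of multiplicity $2$ in $\mathcal{A}^H$ is less than $2^{96}$ (a bound independent of $n$).
   Context: Work in complex projective space $\mathbb{P}^3$ with homogeneous coordinates $[x_0:x_1:x_2:x_3]$. For an integer $n\ge 1$ let $$Q_n=[(x_0^n-x_1^n)(x_2^n-x_3^n)]\,[(x_0^n-x_2^n)(x_1^n-x_3^n)]\,[(x_0^n-x_3^n)(x_1^n-x_2^n)].$$ The planes of $Q_n$ are the $6n$ planes $x_i=\zeta x_j$ with $0\le i<j\le 3$ and $\zeta^n=1$. They are partitioned into three blocks given by the three brackets: a plane $x_i=\zeta x_j$ belongs to the block determined by the bracket containing the factor $x_i^n-x_j^n$. Let $H\subset\mathbb{P}^3$ be a plane that is not one of the planes of $Q_n$. The induced arrangement $\mathcal{A}^H$ is the multi-arrangement of lines in $H\cong\mathbb{P}^2$ obtained by intersecting the planes of $Q_n$ with $H$. It inherits the partition into three blocks, each of total degree $d=2n$. The multiplicity of a line $\ell\subset H$ in a block is the number of planes $L$ of that block with $L\cap H=\ell$. A fixed component of $\mathcal{A}^H$ is a line of $H$ contained in planes of $Q_n$ from different blocks (equivalently, from all three blocks). If $\mathcal{A}^H$ has no fixed component, then $\mathcal{A}^H$ with its three blocks is called the induced multinet. Let $\mathcal{X}$ be the set of points of $H$ lying on lines of $\mathcal{A}^H$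 from different blocks. For $P\in\mathcal{X}$, the multiplicity of $P$ is the sum of the multiplicities of the lines of one block passing through $P$, i.e. the number of planes of $Q_n$ from one block passing through $P$ (this number does not depend on the block). The induced multinet $\mathcal{A}^H$ is called light if every line of it has multiplicity $1$ and it is not a net, i.e. $|\mathcal{X}|<d^2$ (equivalently, some point of $\mathcal{X}$ has multiplicity greater than $1$). *)

(* Defs.v *)
From HB Require Import structures.
From mathcomp Require Import all_boot all_order all_algebra.
From mathcomp Require Import finmap boolp classical_sets functions cardinality.
From mathcomp Require Import reals complex.

Set Implicit Arguments.
Unset Strict Implicit.
Unset Printing Implicit Defensive.

Import Order.TTheory GRing.Theory Num.Theory.
Local Open Scope classical_set_scope.
Local Open Scope ring_scope.

(** The complex numbers are [complex R] for a real type [R].  Points, lines and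
    planes of the projective space P^3 are the linear subspaces of dimension
    1, 2 and 3 of [V4 R]; incidence is inclusion of subspaces. *)
Notation V4 R := ('rV[complex R]_4).

Definition coord_plane (R : realType) (i j : 'I_4) (zeta : complex R) :
    {vspace V4 R} :=
  lker (linfun (fun x : V4 R => x 0 i - zeta * x 0 j : (complex R)^o)).

Lemma mem_coord_plane (R : realType) (i j : 'I_4) (zeta : complex R) (x : V4 R) :
  (x \in coord_plane i j zeta) = (x 0 i == zeta * x 0 j).
Proof.
pose f (y : V4 R) : (complex R)^o := y 0 i - zeta * y 0 j.
have f_lin : linear f.
  move=> a u v; rewrite /f !mxE.
  change (a * u 0 i + v 0 i - zeta * (a * u 0 j + v 0 j) =
    a * (u 0 i - zeta * u 0 j) + (v 0 i - zeta * v 0 j)).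
  by rewrite mulrBr mulrDr opprD addrACA mulrCA.
pose F : {linear V4 R -> (complex R)^o} :=
  HB.pack f (GRing.isLinear.Build _ _ _ _ f f_lin).
by rewrite memv_ker (lfunE F) /= /f subr_eq0.
Qed.

(** The pairs (i, j) of the factors x_i^n - x_j^n in each bracket of Q_n. *)
Definition bracket (b : 'I_3) : seq ('I_4 * 'I_4) :=
  let x0 := @Ordinal 4 0 isT in let x1 := @Ordinal 4 1 isT in
  let x2 := @Ordinal 4 2 isT in let x3 := @Ordinal 4 3 isT in
  nth [::] [:: [:: (x0, x1); (x2, x3)];
               [:: (x0, x2); (x1, x3)];
               [:: (x0, x3); (x1, x2)]] b.

Definition block (R : realType) (n : nat) (b : 'I_3) : set {vspace V4 R} :=
  [set L | exists i j (zeta : complex R),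
    [/\ (i, j) \in bracket b, zeta ^+ n = 1 & L = coord_plane i j zeta]].

Definition planes (R : realType) (n : nat) : set {vspace V4 R} :=
  [set L | exists b, block n b L].

Lemma finite_block (R : realType) (n : nat) (b : 'I_3) :
  (0 < n)%N -> finite_set (@block R n b).
Proof.
move=> n0; have fin_roots : finite_set [set z : complex R | z ^+ n = 1].
  pose p : {poly complex R} := 'X^n - 1.
  have p0 : p != 0 by rewrite -size_poly_eq0 /p size_XnsubC.
  have [rs rsP] := closed_field_poly_normal p.
  apply: (@sub_finite_set _ _ [set` rs]); last exact: finite_seq.
  move=> z /= zn.
  have : root p z by rewrite /root /p !hornerE zn subrr.
  rewrite rsP rootZ ?lead_coef_eq0 // root_prod_XsubC //.
pose f (t : ('I_4 * 'I_4) * complex R) := coord_plane t.1.1 t.1.2 t.2.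
apply: (@sub_finite_set _ _
  (f @` ([set: 'I_4 * 'I_4] `*` [set z : complex R | z ^+ n = 1]))).
  by move=> L [i [j [z [_ zn ->]]]]; exists ((i, j), z).
by apply: finite_image; apply: finite_setX => //; exact: finite_finset.
Qed.

Section InducedArrangement.
Variables (R : realType) (n : nat) (H : {vspace V4 R}).
Implicit Types (b : 'I_3) (l P : {vspace V4 R}).

Definition line b : set {vspace V4 R} :=
  [set (L :&: H)%VS | L in block n b].

Definition line_mult b l : nat :=
  #|` fset_set [set L | block n b L /\ (L :&: H)%VS = l]|%fset.

Definition fixed_component l : Prop :=
  [/\ \dim l = 2%N, (l <= H)%VS &
    exists b1 b2 L1 L2, [/\ b1 != b2, block n b1 L1, block n b2 L2,
      (l <= L1)%VS & (l <= L2)%VS]].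

Definition induced_multinet : Prop := ~ exists l, fixed_component l.

Definition base_locus : set {vspace V4 R} :=
  [set P | [/\ \dim P = 1%N, (P <= H)%VS &
    exists b1 b2 l1 l2, [/\ b1 != b2, line b1 l1, line b2 l2,
      (P <= l1)%VS & (P <= l2)%VS]]].

(** The number of planes of a block through a point of [base_locus] is the same
    for the three blocks; asking for [m] in every block avoids singling one
    out. *)
Definition point_mult P (m : nat) : Prop :=
  forall b, #|` fset_set [set L | block n b L /\ (P <= L)%VS]|%fset = m.

(** [fset_set] is empty on infinite sets, hence the explicit finiteness. *)
Definition card_less (A : set {vspace V4 R}) (m : nat) : Prop :=
  finite_set A /\ (#|` fset_set A|%fset < m)%N.

Definition light : Prop :=
  [/\ induced_multinet,
      forall b l, line b l -> line_mult b l = 1%N &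
      card_less base_locus ((2 * n) ^ 2)%N].

Definition points_of_mult (m : nat) : set {vspace V4 R} :=
  [set P | base_locus P /\ point_mult P m].

End InducedArrangement.

(* Main.v *)
(* Let a be the coefficient vector of H.  No point of multiplicity n means that
   all a_i are nonzero, and then the points of multiplicity 2 are the points
   (1, x, y, z) of H whose coordinates are n-th roots of unity.  Lightness says
   that no proper subsum of a_0 + a_1 x + a_2 y + a_3 z vanishes, because a
   vanishing subsum exhibits a line of H lying on two planes of one block.  It
   remains to bound the nondegenerate solutions of one linear equation in roots
   of unity; we get the bound 110, following the method of Beukers and Smyth.

   - Two independent linear equations have at most 2 nondegenerate solutions:
     eliminate to three terms and use |x| = 1.
   - So either there are at most 2 solutions or three solutions determine a,
     which then may be taken in a cyclotomic field Q(z).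
   - Write the order of z as 2^e m with m odd.  If e >= 2, the conjugation
     z -> -z turns a solution into a second linear equation, with one of 8 sign
     patterns; it is independent of the first unless a twist of a lies in
     Q(z^2), in which case we induct on e.  Solutions with a larger 2-part than
     z are treated likewise, the conjugation now fixing a.
   - If m is the order of z, squaring of odd order roots yields a quadric
     sum d_i w_i^2 = 0 besides the plane sum b_i w_i = 0.  On the plane, this
     conic and the cubic given by complex conjugation, sum conj(b_i) / w_i = 0,
     meet in few points unless d_0 / b_0^2 + d_1 / b_1^2 = 0 and
     d_2 / b_2^2 + d_3 / b_3^2 = 0 up to order; in that case the quadric divided
     by b_0 w_0 + b_1 w_1 is a second linear equation. *)
Require Import Defs.
From mathcomp Require Import all_boot all_order all_algebra all_solvable all_field.
From mathcomp Require Import finmap boolp classical_sets functions cardinality.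
From mathcomp Require Import reals complex.
From mathcomp Require Import ring zify.

Set Implicit Arguments.
Unset Strict Implicit.
Unset Printing Implicit Defensive.

Import Order.TTheory GRing.Theory Num.Theory.
Local Open Scope classical_set_scope.
Local Open Scope ring_scope.

(** * Covering by few points *)

(** Bounds the size of a predicate not yet known to be finite: the list may repeat or contain other
    points, so bounds pass to subsets, images and unions. *)
Definition covered (T : eqType) (P : T -> Prop) (k : nat) : Prop :=
  exists2 s : seq T, (size s <= k)%N & forall x, P x -> x \in s.

Section Covered.
Variables (T U : eqType).
Implicit Types (P Q : T -> Prop) (k l : nat).

Lemma covered_sub P Q k l :
  (k <= l)%N -> (forall x, P x -> Q x) -> covered Q k -> covered P l.
Proof.
by move=> kl PQ [s sk Qs]; exists s => [|x /PQ/Qs//]; exact: leq_trans kl.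
Qed.

Lemma covered_le P k l : (k <= l)%N -> covered P k -> covered P l.
Proof. by move=> kl; exact: covered_sub. Qed.

Lemma covered_none P k : (forall x, ~ P x) -> covered P k.
Proof. by move=> NP; exists [::] => // x /NP. Qed.

Lemma covered_image (g : U -> T) P (Q : U -> Prop) k :
  (forall x, P x -> exists2 t, Q t & x = g t) -> covered Q k -> covered P k.
Proof.
move=> PQ [s sk Qs]; exists (map g s); first by rewrite size_map.
by move=> _ /PQ [t /Qs ts ->]; exact: map_f.
Qed.

Lemma coveredU P Q k l :
  covered P k -> covered Q l -> covered (fun x => P x \/ Q x) (k + l).
Proof.
move=> [s sk Ps] [t tl Qt]; exists (s ++ t); first by rewrite size_cat leq_add.
by move=> x; rewrite mem_cat => -[/Ps ->|/Qt ->] //; rewrite orbT.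
Qed.

Lemma covered_bigcup (I : eqType) (r : seq I) (P : I -> T -> Prop) k :
  (forall i, i \in r -> covered (P i) k) ->
  covered (fun x => exists2 i, i \in r & P i x) (size r * k).
Proof.
elim: r => [|i r IH] Pk; first by apply: covered_none => x [j].
rewrite /= mulSn; have {}IH := IH (fun j jr => Pk j (mem_behead (s := i :: r) jr)).
apply: covered_sub (coveredU (Pk i (mem_head _ _)) IH) => // x [j].
by rewrite inE => /orP[/eqP->|jr] Px; [left|right; exists j].
Qed.

Lemma covered_fiber P (f : T -> U) (Q : U -> Prop) k l :
  covered Q k -> (forall x, P x -> Q (f x)) ->
  (forall t, covered (fun x => P x /\ f x = t) l) -> covered P (k * l).
Proof.
move=> [s sk Qs] PQ fib; have := @covered_bigcup _ s _ _ (fun t _ => fib t).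
apply: covered_sub; first by rewrite leq_mul2r sk orbT.
by move=> x Px; exists (f x) => //; apply/Qs/PQ.
Qed.

End Covered.

Lemma covered_root (F : closedFieldType) (p : {poly F}) (k : nat) :
  p != 0 -> (size p <= k.+1)%N -> covered (fun x => root p x) k.
Proof.
move=> p0 sp; have [r Dp] := closed_field_poly_normal p.
exists r; last by move=> x; rewrite Dp rootZ ?lead_coef_eq0 // root_prod_XsubC.
by move: sp; rewrite Dp size_scale ?lead_coef_eq0 // size_prod_XsubC.
Qed.

Lemma covered_quadratic (F : closedFieldType) (a b c : F) :
  a != 0 -> covered (fun x => a * x ^+ 2 + b * x + c = 0) 2.
Proof.
move=> a0; set p := a *: 'X^2 + b *: 'X + c%:P.
have sp : size p = 3.
  rewrite /p -addrA size_polyDl; first by rewrite size_scale // size_polyXn.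
  rewrite size_scale // size_polyXn; apply: leq_ltn_trans (size_polyD _ _) _.
  rewrite gtn_max (leq_ltn_trans (size_scale_leq _ _)) ?size_polyX //=.
  by rewrite size_polyC; case: (c == 0).
have p0 : p != 0 by rewrite -size_poly_eq0 sp.
apply: covered_sub (covered_root (k := 2) p0 _); rewrite ?sp //.
by move=> x Hx; rewrite /root -Hx /p !hornerE; apply/eqP; ring.
Qed.

(** * Unimodular solutions of linear and quadratic equations *)

Section Unimodular.
Variable C : numClosedFieldType.
Implicit Types (a b : C) (t : C * C * C).

Lemma unim_neq0 (x : C) : `|x| = 1 -> x != 0.
Proof. by move=> x1; rewrite -normr_eq0 x1 oner_eq0. Qed.

Lemma unim_conj (x : C) : `|x| = 1 -> x^* * x = 1.
Proof. by move=> x1; rewrite mulrC -normCK x1 expr1n. Qed.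

Lemma norm_unity_root n (x : C) : (0 < n)%N -> x ^+ n = 1 -> `|x| = 1.
Proof.
move=> n0 xn; apply/eqP; rewrite -(@pexpr_eq1 _ _ n) ?normr_ge0 //.
by rewrite -normrX xn normr1.
Qed.

Lemma norm_prim_root n (x : C) : n.-primitive_root x -> `|x| = 1.
Proof. by move=> xP; apply: norm_unity_root (prim_order_gt0 xP) (prim_expr_order xP). Qed.

(** Conjugation inverts x and y, so multiplying c y by its conjugate eliminates y and leaves a
    quadratic in x with leading coefficient [b * a^*]; then x determines y. *)
Lemma covered_three_term a b c : a != 0 -> b != 0 -> c != 0 ->
  covered (fun t : C * C => [/\ `|t.1| = 1, `|t.2| = 1 &
                               a + b * t.1 + c * t.2 = 0]) 2.
Proof.
move=> a0 b0 c0.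
have q0 : b * a^* != 0 by rewrite mulf_neq0 // conjC_eq0.
have := covered_quadratic (a * a^* + b * b^* - c * c^*) (a * b^*) q0.
apply: (@covered_image _ _ (fun x => (x, - (a + b * x) / c))).
move=> [x y] /= [x1 y1 e].
have cy : c * y = - (a + b * x) by apply/eqP; rewrite -subr_eq0 opprK -e; apply/eqP; ring.
exists x; last by rewrite -cy [c * y]mulrC mulfK.
have ec : a^* + b^* * x^* + c^* * y^* = 0.
  by rewrite -!rmorphM -!rmorphD e rmorph0.
have Hx := unim_conj x1; have Hy := unim_conj y1.
have : (c * y) * (c^* * y^*) * x = c * c^* * x by rewrite -[RHS]mulr1 -Hy; ring.
have -> : c^* * y^* = - (a^* + b^* * x^*).
  by apply/eqP; rewrite -subr_eq0 opprK -ec; apply/eqP; ring.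
rewrite cy => h.
have : a * a^* * x + a * b^* * (x^* * x) + b * a^* * x ^+ 2 + b * b^* * x * (x^* * x) =
       c * c^* * x by rewrite -h; ring.
rewrite Hx => {}h.
have : a * a^* * x + a * b^* * 1 + b * a^* * x ^+ 2 + b * b^* * x * 1 - c * c^* * x = 0.
  by rewrite h subrr.
by move<-; ring.
Qed.

(** Unimodular points of a plane on which no proper subsum vanishes, in the
    affine chart x_0 = 1. *)
Definition nondeg_sol (a0 a1 a2 a3 : C) t : Prop :=
  let: (x, y, z) := t in
  [/\ `|x| = 1, `|y| = 1, `|z| = 1, a0 + a1 * x + a2 * y + a3 * z = 0 &
      [/\ a0 + a1 * x != 0, a0 + a2 * y != 0 & a0 + a3 * z != 0]].

Lemma nondeg_sol_swap12 a0 a1 a2 a3 x y z :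
  nondeg_sol a0 a1 a2 a3 (x, y, z) -> nondeg_sol a0 a2 a1 a3 (y, x, z).
Proof. by move=> [? ? ? e [? ? ?]]; split => //; rewrite -e; ring. Qed.

Lemma nondeg_sol_swap23 a0 a1 a2 a3 x y z :
  nondeg_sol a0 a1 a2 a3 (x, y, z) -> nondeg_sol a0 a1 a3 a2 (x, z, y).
Proof. by move=> [? ? ? e [? ? ?]]; split => //; rewrite -e; ring. Qed.

Lemma covered_swap12 (P Q : C * C * C -> Prop) k :
  (forall x y z, P (x, y, z) -> Q (y, x, z)) -> covered Q k -> covered P k.
Proof.
move=> PQ; apply: (@covered_image _ _ (fun t => (t.1.2, t.1.1, t.2))).
by move=> [[x y] z] /PQ Hq; exists (y, x, z).
Qed.

Lemma covered_swap23 (P Q : C * C * C -> Prop) k :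
  (forall x y z, P (x, y, z) -> Q (x, z, y)) -> covered Q k -> covered P k.
Proof.
move=> PQ; apply: (@covered_image _ _ (fun t => (t.1.1, t.2, t.1.2))).
by move=> [[x y] z] /PQ Hq; exists (x, z, y).
Qed.

(** Substituting for y leaves three terms; if the coefficient of x cancels, then a0 + a3 z = 0,
    which nondegeneracy excludes. *)
Lemma covered_two_term a0 a1 a2 a3 k1 k2 : a0 != 0 -> a3 != 0 -> k2 != 0 ->
  covered (fun t => nondeg_sol a0 a1 a2 a3 t /\ k1 * t.1.1 + k2 * t.1.2 = 0) 2.
Proof.
move=> a00 a30 k20; pose b := a1 - a2 * (k1 / k2).
have Dy x y : k1 * x + k2 * y = 0 -> y = - (k1 / k2) * x.
  move=> e; apply: (mulfI k20); rewrite -[LHS](addKr (k1 * x)) e.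
  by field.
have [b0|b0] := eqVneq b 0.
  apply: covered_none => -[[x y] z] /= [[_ _ _ e [_ _ /eqP Nz]] /Dy Ey].
  by apply: Nz; rewrite -e Ey -[LHS]addr0 -(mul0r x) -b0 /b; field.
have := covered_three_term a00 b0 a30.
apply: (@covered_image _ _ (fun s => (s.1, - (k1 / k2) * s.1, s.2))).
move=> [[x y] z] /= [[x1 y1 z1 e _] /Dy Ey]; exists (x, z); rewrite /= -?Ey //.
by split => //; rewrite -e Ey /b; field.
Qed.

(** Eliminating the constant term gives c1 x + c2 y + c3 z = 0. With three nonzero coefficients this
    is a three-term equation in y / x and z / x, and the first equation recovers x; with two it is a
    permuted [covered_two_term]; with one there is no solution. *)
Lemma covered_two_linear a0 a1 a2 a3 b0 b1 b2 b3 :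
  a0 != 0 -> a1 != 0 -> a2 != 0 -> a3 != 0 ->
  [|| a0 * b1 != b0 * a1, a0 * b2 != b0 * a2 | a0 * b3 != b0 * a3] ->
  covered (fun t => nondeg_sol a0 a1 a2 a3 t /\
                    b0 + b1 * t.1.1 + b2 * t.1.2 + b3 * t.2 = 0) 2.
Proof.
move=> a00 a10 a20 a30.
pose c1 := a0 * b1 - b0 * a1; pose c2 := a0 * b2 - b0 * a2.
pose c3 := a0 * b3 - b0 * a3.
rewrite -(subr_eq0 (a0 * b1)) -(subr_eq0 (a0 * b2)) -(subr_eq0 (a0 * b3)).
rewrite -/c1 -/c2 -/c3 => cN0.
suff: covered (fun t => nondeg_sol a0 a1 a2 a3 t /\
                        c1 * t.1.1 + c2 * t.1.2 + c3 * t.2 = 0) 2.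
  apply: covered_sub => // -[[x y] z] /= [h e2]; split => //.
  have [_ _ _ e1 _] := h.
  have <- : a0 * 0 - b0 * 0 = 0 by rewrite !mulr0 subr0.
  by rewrite -[in a0 * 0]e2 -[in b0 * 0]e1 /c1 /c2 /c3; ring.
move: c1 c2 c3 cN0 => c1 c2 c3.
have [->|c30] := eqVneq c3 0.
  have [->|c20] := eqVneq c2 0.
    rewrite /= !orbF => c10; apply: covered_none => -[[x y] z] /= [[x1 _ _ _ _]].
    by rewrite !mul0r !addr0 => /eqP; rewrite mulf_eq0 (negPf c10) (negPf (unim_neq0 x1)).
  move=> _; have := covered_two_term a1 a2 c1 a00 a30 c20.
  by apply: covered_sub => // t [? e]; split => //; rewrite -e mul0r addr0.
have [->|c20] := eqVneq c2 0.
  move=> _; have := covered_two_term a1 a3 c1 a00 a20 c30.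
  apply: covered_swap23 => x y z /= [/nondeg_sol_swap23 h e]; split => //.
  by rewrite -e mul0r addr0.
have [->|c10] := eqVneq c1 0 => _.
  have := covered_two_term a2 a3 c2 a00 a10 c30.
  apply: (@covered_image _ _ (fun s => (s.2, s.1.1, s.1.2))).
  move=> [[x y] z] /= [/nondeg_sol_swap12/nondeg_sol_swap23 h e].
  by exists (y, z, x) => //; split => //=; rewrite -e mul0r add0r.
have := covered_three_term c10 c20 c30.
apply: (@covered_image _ _ (fun s => let x := - a0 / (a1 + a2 * s.1 + a3 * s.2) in
  (x, s.1 * x, s.2 * x))).
move=> [[x y] z] /= [[x1 y1 z1 e _] e2]; have x0 := unim_neq0 x1.
exists (y / x, z / x); rewrite /=.
  rewrite !normrM !normfV x1 y1 z1 invr1 mulr1; split => //.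
  by apply: (mulIf x0); rewrite mul0r -e2; field.
have Ea : (a1 + a2 * (y / x) + a3 * (z / x)) * x = - a0.
  by rewrite -[RHS]addr0 -e; field.
have N0 : a1 + a2 * (y / x) + a3 * (z / x) != 0.
  by apply: contraNneq a00 => h0; rewrite -oppr_eq0 -Ea h0 mul0r.
have <- : x = - a0 / (a1 + a2 * (y / x) + a3 * (z / x)).
  by rewrite -Ea mulrC mulKf.
by rewrite !mulfVK.
Qed.

(** * Unimodular points on a plane and a quadric *)

Lemma quadratic_resultant a b c a' b' c' y :
  a * y ^+ 2 + b * y + c = 0 -> a' * y ^+ 2 + b' * y + c' = 0 ->
  (a * c' - a' * c) ^+ 2 - (a * b' - a' * b) * (b * c' - c * b') = 0 :> C.
Proof.
move=> e e'.
have -> : c = - (a * y ^+ 2 + b * y).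
  by apply/eqP; rewrite -subr_eq0 opprK -e; apply/eqP; ring.
have -> : c' = - (a' * y ^+ 2 + b' * y).
  by apply/eqP; rewrite -subr_eq0 opprK -e'; apply/eqP; ring.
ring.
Qed.

(** The resultant has degree at most 6 in x, and its value at 0 is nonzero by the conditions on the
    index pairs 0, 2 and 0, 3. The condition on 2, 3 leaves at most two y over each x, and the plane
    gives z. *)
Lemma covered_linear_quadric_transverse b0 b1 b2 b3 d0 d1 d2 d3 :
  b0 != 0 -> b1 != 0 -> b2 != 0 -> b3 != 0 ->
  d0 * b2 ^+ 2 + d2 * b0 ^+ 2 != 0 -> d0 * b3 ^+ 2 + d3 * b0 ^+ 2 != 0 ->
  d2 * b3 ^+ 2 + d3 * b2 ^+ 2 != 0 ->
  covered (fun t => [/\ `|t.1.1| = 1, `|t.1.2| = 1, `|t.2| = 1,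
     b0 + b1 * t.1.1 + b2 * t.1.2 + b3 * t.2 = 0 &
     d0 + d1 * t.1.1 ^+ 2 + d2 * t.1.2 ^+ 2 + d3 * t.2 ^+ 2 = 0]) 12.
Proof.
move=> b00 b10 b20 b30 h02 h03 h23.
(* Eliminating t.2 from the conjugate equation and from the quadric leaves the
   quadratics A y^2 + B y + D and G2 y^2 + G1 y + G0 in y = t.1.2, whose
   coefficients are polynomials in x = t.1.1; R is their resultant. *)
pose c0 := b0^*; pose c1 := b1^*; pose c2 := b2^*; pose c3 := b3^*.
pose A : {poly C} := b2 *: (c1%:P + c0 *: 'X).
pose B : {poly C} := (c1%:P + c0 *: 'X) * (b0%:P + b1 *: 'X) +
                     (c2 * b2 - c3 * b3) *: 'X.
pose D : {poly C} := c2 *: ('X * (b0%:P + b1 *: 'X)).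
pose G2 : C := d2 * b3 ^+ 2 + d3 * b2 ^+ 2.
pose G1 : {poly C} := (2 * d3 * b2) *: (b0%:P + b1 *: 'X).
pose G0 : {poly C} := b3 ^+ 2 *: (d0%:P + d1 *: 'X^2) +
                      d3 *: (b0%:P + b1 *: 'X) ^+ 2.
pose R := (A * G0 - G2 *: D) ^+ 2 - (A * G1 - G2 *: B) * (B * G0 - D * G1).
have hE := (hornerD, hornerN, hornerM, hornerZ, hornerC, hornerX, hornerXn, horner_exp).
have szD (p q : {poly C}) k : (size p <= k -> size q <= k -> size (p + q)%R <= k)%N.
  by move=> sp sq; apply: leq_trans (size_polyD _ _) _; rewrite geq_max sp.
have szB (p q : {poly C}) k : (size p <= k -> size q <= k -> size (p - q)%R <= k)%N.
  by move=> sp sq; apply: (szD); rewrite ?size_polyN.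
have szM (p q : {poly C}) i j : (size p <= i.+1 -> size q <= j.+1 ->
    size (p * q)%R <= (i + j).+1)%N.
  move=> sp sq; apply: leq_trans (size_polyMleq _ _) _.
  by rewrite -subn1 leq_subLR add1n -addSn -addnS leq_add.
have szZ c (p : {poly C}) k : (size p <= k -> size (c *: p)%R <= k)%N.
  exact: leq_trans (size_scale_leq _ _).
have szL u v k : (1 < k)%N -> (size (u%:P + v *: 'X : {poly C})%R <= k)%N.
  move=> k1; apply: (szD); last by apply: (szZ); rewrite size_polyX.
  by rewrite (leq_trans (size_polyC_leq1 _)) // ltnW.
have sA : (size A <= 2)%N by apply/szZ/szL.
have sB : (size B <= 3)%N.
  by apply: (szD); [apply: (szM _ _ 1 1)%N; exact: szL|apply: (szZ); rewrite size_polyX].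
have sD : (size D <= 3)%N.
  by apply: (szZ); apply: (szM _ _ 1 1)%N; [rewrite size_polyX|exact: szL].
have sG1 : (size G1 <= 2)%N by apply/szZ/szL.
have sG0 : (size G0 <= 3)%N.
  apply: (szD); apply: (szZ); last by rewrite expr2; apply: (szM _ _ 1 1)%N; exact: szL.
  apply: (szD); first exact: leq_trans (size_polyC_leq1 _) _.
  by apply: (szZ); rewrite size_polyXn.
have sR : (size R <= 7)%N.
  apply: (szB).
    rewrite expr2; apply: (szM _ _ 3 3)%N; apply: (szB); rewrite ?(szM _ _ 1 2)%N //;
    by apply: (szZ); exact: leq_trans sD _.
  apply: (szM _ _ 2 4)%N; apply: (szB).
  - exact: (szM _ _ 1 1)%N.
  - exact: szZ.
  - exact: (szM _ _ 2 2)%N.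
  - by apply: leq_trans (szM _ _ 2 1 _ _)%N _.
have R0 : R != 0.
  have : R.[0] != 0.
    have -> : R.[0] = c1 ^+ 2 * (d0 * b3 ^+ 2 + d3 * b0 ^+ 2) * b3 ^+ 2 *
                      (d0 * b2 ^+ 2 + d2 * b0 ^+ 2).
      by rewrite /R /A /B /D /G2 /G1 /G0 !hE; ring.
    by rewrite !mulf_neq0 ?expf_neq0 // /c1 conjC_eq0.
  by apply: contraNneq => ->; rewrite horner0.
have elim x y z : [/\ `|x| = 1, `|y| = 1, `|z| = 1,
     b0 + b1 * x + b2 * y + b3 * z = 0 &
     d0 + d1 * x ^+ 2 + d2 * y ^+ 2 + d3 * z ^+ 2 = 0] ->
   [/\ A.[x] * y ^+ 2 + B.[x] * y + D.[x] = 0,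
       G2 * y ^+ 2 + G1.[x] * y + G0.[x] = 0 &
       z = - (b0 + b1 * x + b2 * y) / b3].
  move=> [x1 y1 z1 e1 e2].
  have ez : b3 * z = - (b0 + b1 * x + b2 * y).
    by apply/eqP; rewrite -subr_eq0 opprK -e1; apply/eqP; ring.
  split; last by rewrite -ez [b3 * z]mulrC mulfK.
    have ec : c0 + c1 * x^* + c2 * y^* + c3 * z^* = 0.
      by rewrite /c0 /c1 /c2 /c3 -!rmorphM -!rmorphD e1 rmorph0.
    have {}ec : (c0 + c1 * x^* + c2 * y^* + c3 * z^*) * (x * y * (b3 * z)) = 0.
      by rewrite ec mul0r.
    have {}ec : c0 * x * y * (b3 * z) + c1 * (x^* * x) * y * (b3 * z) +
                c2 * (y^* * y) * x * (b3 * z) + c3 * (z^* * z) * x * y * b3 = 0.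
      by rewrite -[RHS]ec; ring.
    move: ec; rewrite !unim_conj // ez => ec.
    rewrite -[RHS]oppr0 -[in RHS]ec.
    by rewrite /A /B /D !hE; clearbody c0 c1 c2 c3; ring.
  have : b3 ^+ 2 * (d0 + d1 * x ^+ 2 + d2 * y ^+ 2) + d3 * (b3 * z) ^+ 2 = 0.
    by rewrite -(mulr0 (b3 ^+ 2)) -e2; ring.
  by rewrite ez => <-; rewrite /G2 /G1 /G0 !hE; ring.
have -> : 12%N = (6 * 2)%N by [].
apply: (covered_fiber (f := fun t => t.1.1) (covered_root R0 sR)).
  move=> [[x y] z] /elim [eF eG _] /=; rewrite /root.
  apply/eqP; rewrite -(quadratic_resultant eF eG).
  by rewrite /R !hE.
move=> x; have := covered_quadratic G1.[x] G0.[x] h23.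
apply: (@covered_image _ _ (fun y => (x, y, - (b0 + b1 * x + b2 * y) / b3))).
by move=> [[x' y] z] [/elim [_ eG ez] /= ex]; subst x'; exists y => //; rewrite -ez.
Qed.

Lemma covered_linear_quadric_paired b0 b1 b2 b3 d0 d1 d2 d3 :
  b0 != 0 -> b1 != 0 -> b2 != 0 -> b3 != 0 -> d0 != 0 -> d2 != 0 ->
  d0 * b1 ^+ 2 + d1 * b0 ^+ 2 = 0 -> d2 * b3 ^+ 2 + d3 * b2 ^+ 2 = 0 ->
  covered (fun t => nondeg_sol b0 b1 b2 b3 t /\
     d0 + d1 * t.1.1 ^+ 2 + d2 * t.1.2 ^+ 2 + d3 * t.2 ^+ 2 = 0) 2.
Proof.
move=> b00 b10 b20 b30 d00 d20 h01 h23.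
pose q0 := d0 / b0 ^+ 2; pose q2 := d2 / b2 ^+ 2.
have q00 : q0 != 0 by rewrite mulf_neq0 // invr_eq0 expf_neq0.
have E0 : d0 = q0 * b0 ^+ 2 by rewrite /q0; field.
have E2 : d2 = q2 * b2 ^+ 2 by rewrite /q2; field.
clearbody q0 q2.
have E1 : d1 = - q0 * b1 ^+ 2.
  apply: (mulIf (expf_neq0 2 b00)); rewrite -[LHS](addKr (d0 * b1 ^+ 2)) h01 E0; ring.
have E3 : d3 = - q2 * b3 ^+ 2.
  apply: (mulIf (expf_neq0 2 b20)); rewrite -[LHS](addKr (d2 * b3 ^+ 2)) h23 E2; ring.
(* On the plane both difference-of-squares summands of the quadric contain the
   nonzero factor b0 + b1 x = - (b2 y + b3 z). *)
have nprop : [|| b0 * - (q0 * b1) != q0 * b0 * b1, b0 * - (q2 * b2) != q0 * b0 * b2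
   | b0 * (q2 * b3) != q0 * b0 * b3].
  apply/orP; left; rewrite -subr_eq0.
  have -> : b0 * - (q0 * b1) - q0 * b0 * b1 = - (2 * (q0 * b0 * b1)) by ring.
  by rewrite oppr_eq0 !mulf_neq0 ?pnatr_eq0.
apply: covered_sub (covered_two_linear b00 b10 b20 b30 nprop) => //.
move=> [[x y] z] /= [h e2]; split=> //; have [_ _ _ e1 [n01 _ _]] := h.
apply: (mulfI n01); rewrite mulr0 -e2 E0 E1 E2 E3.
have e : b2 * y + b3 * z = - (b0 + b1 * x).
  by apply/eqP; rewrite -subr_eq0 opprK -e1; apply/eqP; ring.
have -> : q0 * b0 ^+ 2 + - q0 * b1 ^+ 2 * x ^+ 2 + q2 * b2 ^+ 2 * y ^+ 2 +
  - q2 * b3 ^+ 2 * z ^+ 2 = q0 * (b0 - b1 * x) * (b0 + b1 * x) +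
  q2 * (b2 * y - b3 * z) * (b2 * y + b3 * z) by ring.
by rewrite e; ring.
Qed.

(** Call i and j matched when d_i / b_i^2 + d_j / b_j^2 = 0. This graph on four vertices has no
    triangle, so it has a perfect matching, which is the paired case, or three pairwise unmatched
    vertices, which is the transverse case. *)
Lemma covered_linear_quadric b0 b1 b2 b3 d0 d1 d2 d3 :
  b0 != 0 -> b1 != 0 -> b2 != 0 -> b3 != 0 ->
  d0 != 0 -> d1 != 0 -> d2 != 0 -> d3 != 0 ->
  covered (fun t => nondeg_sol b0 b1 b2 b3 t /\
     d0 + d1 * t.1.1 ^+ 2 + d2 * t.1.2 ^+ 2 + d3 * t.2 ^+ 2 = 0) 12.
Proof.
move=> b00 b10 b20 b30 d00 d10 d20 d30.
pose m (b b' d d' : C) := d * b' ^+ 2 + d' * b ^+ 2 == 0.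
have m_sym b b' d d' : m b b' d d' = m b' b d' d by rewrite /m addrC.
(* d / b^2 cannot be opposite to two mutually opposite values *)
have m3 b b' b'' d d' d'' : b != 0 -> b' != 0 -> b'' != 0 -> d != 0 ->
    m b b' d d' -> m b b'' d d'' -> ~~ m b' b'' d' d''.
  move=> nb nb' nb'' nd /eqP h1 /eqP h2; apply/negP => /eqP h3.
  have : 2 * (d * b' ^+ 2 * b'' ^+ 2) = 0.
    have -> : 2 * (d * b' ^+ 2 * b'' ^+ 2) =
      (d * b' ^+ 2 + d' * b ^+ 2) * b'' ^+ 2 + (d * b'' ^+ 2 + d'' * b ^+ 2) * b' ^+ 2
      - (d' * b'' ^+ 2 + d'' * b' ^+ 2) * b ^+ 2 by ring.
    by rewrite h1 h2 h3 !mul0r subr0 addr0.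
  by apply/eqP; rewrite !mulf_neq0 ?expf_neq0 ?pnatr_eq0.
have [/andP[/eqP p01 /eqP p23]|N1] := boolP (m b0 b1 d0 d1 && m b2 b3 d2 d3).
  exact: covered_sub (covered_linear_quadric_paired b00 b10 b20 b30 d00 d20 p01 p23).
have [/andP[/eqP p02 /eqP p13]|N2] := boolP (m b0 b2 d0 d2 && m b1 b3 d1 d3).
  have := covered_linear_quadric_paired b00 b20 b10 b30 d00 d10 p02 p13.
  move/(covered_le (isT : 2 <= 12)%N); apply: covered_swap12.
  by move=> x y z /= [/nondeg_sol_swap12 h e]; split => //=; rewrite -e; ring.
have [/andP[/eqP p03 /eqP p21]|N3] := boolP (m b0 b3 d0 d3 && m b2 b1 d2 d1).
  have := covered_linear_quadric_paired b00 b30 b20 b10 d00 d20 p03 p21.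
  move/(covered_le (isT : 2 <= 12)%N).
  apply: (@covered_image _ _ (fun s => (s.2, s.1.2, s.1.1))).
  move=> [[x y] z] /= [/nondeg_sol_swap12/nondeg_sol_swap23/nondeg_sol_swap12 h e].
  by exists (z, y, x) => //; split => //=; rewrite -e; ring.
have [/and3P[n02 n03 n23]|B1] := boolP [&& ~~ m b0 b2 d0 d2, ~~ m b0 b3 d0 d3 &
    ~~ m b2 b3 d2 d3].
  have := covered_linear_quadric_transverse d1 b00 b10 b20 b30 n02 n03 n23.
  by apply: covered_sub => // -[[x y] z] /= [[]].
have [/and3P[n01 n03 n13]|B2] := boolP [&& ~~ m b0 b1 d0 d1, ~~ m b0 b3 d0 d3 &
    ~~ m b1 b3 d1 d3].
  have := covered_linear_quadric_transverse d2 b00 b20 b10 b30 n01 n03 n13.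
  apply: covered_swap12 => x y z /= [/nondeg_sol_swap12 [? ? ? ? _] e].
  by split => //=; rewrite -e; ring.
have [/and3P[n02 n01 n21]|B3] := boolP [&& ~~ m b0 b2 d0 d2, ~~ m b0 b1 d0 d1 &
    ~~ m b2 b1 d2 d1].
  have := covered_linear_quadric_transverse d3 b00 b30 b20 b10 n02 n01 n21.
  apply: (@covered_image _ _ (fun s => (s.2, s.1.2, s.1.1))).
  move=> [[x y] z] /= [[x1 y1 z1 e1 _] e].
  exists (z, y, x) => //; split => //=; first by rewrite -e1; ring.
  by rewrite -e; ring.
(* For an unmatched triple without index 0, division by x makes index 1 the constant term. *)
have [/and3P[n12 n13 n23]|B0] := boolP [&& ~~ m b1 b2 d1 d2, ~~ m b1 b3 d1 d3 &
    ~~ m b2 b3 d2 d3].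
  have := covered_linear_quadric_transverse d0 b10 b00 b20 b30 n12 n13 n23.
  apply: (@covered_image _ _ (fun s => (s.1.1^-1, s.1.2 / s.1.1, s.2 / s.1.1))).
  move=> [[x y] z] /= [[x1 y1 z1 e1 _] e]; have x0 := unim_neq0 x1.
  exists (x^-1, y / x, z / x); last by rewrite /= invrK !divfK.
  rewrite /= !normrM !normfV x1 y1 z1 invr1 mulr1; split => //.
    by apply: (mulIf x0); rewrite mul0r -e1; field.
  by apply: (mulIf (expf_neq0 2 x0)); rewrite mul0r -e; field.
exfalso; move: N1 N2 N3 B0 B1 B2 B3.
have := m3 b0 b1 b2 d0 d1 d2 b00 b10 b20 d00.
have := m3 b0 b1 b3 d0 d1 d3 b00 b10 b30 d00.
have := m3 b0 b2 b3 d0 d2 d3 b00 b20 b30 d00.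
have := m3 b1 b2 b3 d1 d2 d3 b10 b20 b30 d10.
rewrite (m_sym b2 b1).
case: (m b0 b1 d0 d1); case: (m b0 b2 d0 d2); case: (m b0 b3 d0 d3);
case: (m b1 b2 d1 d2); case: (m b1 b3 d1 d3); case: (m b2 b3 d2 d3) => //= h1 h2 h3 h4;
by [have := h1 isT isT | have := h2 isT isT | have := h3 isT isT | have := h4 isT isT].
Qed.

End Unimodular.

(** * Conjugates of roots of unity *)

Lemma prim_root_exists (F : closedFieldType) (n : nat) :
  n%:R != 0 :> F -> exists z : F, n.-primitive_root z.
Proof.
move=> n0; have n_gt0 : (0 < n)%N by case: n n0 => //; rewrite eqxx.
pose p : {poly F} := 'X^n - 1; have [r Dp] := closed_field_poly_normal p.
rewrite (monicP _) ?monicXnsubC // scale1r in Dp.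
have rn1 : all n.-unity_root r by apply/allP => z; rewrite -root_prod_XsubC -Dp.
have sz_r : (n < (size r).+1)%N.
  by rewrite -(size_prod_XsubC r id) -Dp size_XnsubC.
have [|z] := hasP (has_prim_root n_gt0 rn1 _ sz_r); last by exists z.
by rewrite -separable_prod_XsubC -Dp separable_Xn_sub_1.
Qed.

(** X^n - 1 is the product of the ['Phi_d] with d dividing n, so z is a root of one of them; that
    one divides X^d - 1, hence n divides d. *)
Lemma root_Cyclotomic_prim (F : numFieldType) (n : nat) (z : F) :
  n.-primitive_root z -> root (map_poly intr 'Phi_n) z.
Proof.
move=> zP; have n0 := prim_order_gt0 zP.
have mapXn1 k : map_poly intr ('X^k - 1) = 'X^k - 1 :> {poly F}.
  by rewrite rmorphB /= rmorph1 map_polyXn.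
have [d dn dz] : exists2 d, d \in divisors n & root (map_poly intr 'Phi_d : {poly F}) z.
  have : root (map_poly intr ('X^n - 1) : {poly F}) z.
    by rewrite mapXn1 /root !hornerE prim_expr_order ?subrr.
  rewrite -prod_Cyclotomic // rmorph_prod /root horner_prod prodf_seq_eq0.
  by case/hasP => d dn /= dz; exists d.
suff -> : n = d by [].
rewrite -dvdn_divisors // in dn; have d0 := dvdn_gt0 n0 dn.
apply/eqP; rewrite eqn_dvd dn andbT (prim_order_dvd zP).
rewrite -subr_eq0; have <- : ('X^d - 1).[z] = z ^+ d - 1 by rewrite !hornerE.
rewrite -mapXn1 -prod_Cyclotomic // (big_rem d) -?dvdn_divisors //=.
by rewrite rmorphM hornerM (eqP dz) mul0r.
Qed.

Lemma map_ratr_intr (F : numFieldType) (p : {poly int}) :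
  map_poly (ratr : rat -> F) (map_poly intr p) = map_poly intr p.
Proof. by rewrite -map_poly_comp; apply: eq_map_poly => b; rewrite /= rmorph_int. Qed.

(** Stands for the Galois action on Q(z). ['Phi_n] divides p because it is the minimal polynomial of
    any common root of the two in [algC]. *)
Lemma prim_root_conjugate (F : numFieldType) (n s : nat) (z : F) (p : {poly rat}) :
  n.-primitive_root z -> coprime s n ->
  root (map_poly ratr p) z -> root (map_poly ratr p) (z ^+ s).
Proof.
move=> zP sn pz; pose Phi : {poly rat} := map_poly intr 'Phi_n.
have Phi_z (x : F) : n.-primitive_root x -> root (map_poly ratr Phi) x.
  by move=> xP; rewrite map_ratr_intr root_Cyclotomic_prim.
suff /dvdpP[q ->] : Phi %| p.
  by rewrite rmorphM rootM Phi_z ?orbT // prim_root_exp_coprime.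
have : ~~ coprimep p Phi.
  apply: contraL pz => cp; apply: coprimep_root (Phi_z _ zP).
  by rewrite coprimep_sym coprimep_map.
rewrite /coprimep -(size_map_poly (ratr : rat -> algC)) => g1.
have [x gx] : exists x : algC, root (map_poly ratr (gcdp p Phi)) x.
  by apply/closed_rootP.
have Phi0 : Phi != 0.
  apply: contraNneq (monic_neq0 (Cyclotomic_monic n)) => Phi0; apply/eqP.
  by apply: (map_inj_poly (@intr_inj rat)); rewrite // rmorph0.
have xP : n.-primitive_root x.
  have [w wP] := C_prim_root_exists (prim_order_gt0 zP).
  rewrite -(root_cyclotomic wP) -(Cintr_Cyclotomic wP) -map_ratr_intr -/Phi.
  have /dvdpP[q ->] := dvdp_gcdr p Phi.
  by rewrite rmorphM rootM gx orbT.
have [q [Dq mq qP]] := minCpolyP x.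
have <- : q = Phi.
  apply: (map_inj_poly (fmorph_inj (ratr : rat -> algC))); first exact: rmorph0.
  by rewrite -Dq (minCpoly_cyclotomic xP) -(Cintr_Cyclotomic xP) map_ratr_intr.
rewrite -qP; have /dvdpP[r ->] := dvdp_gcdl p Phi.
by rewrite rmorphM rootM gx orbT.
Qed.

Lemma prim_root_half (F : idomainType) (n : nat) (z : F) :
  (n.*2).-primitive_root z -> z ^+ n = -1.
Proof.
move=> zP; have n0 : (0 < n)%N by have := prim_order_gt0 zP; rewrite double_gt0.
have : (z ^+ n) ^+ 2 = 1 by rewrite -exprM muln2 prim_expr_order.
move/eqP; rewrite sqrf_eq1 -(prim_order_dvd zP) => /orP[/dvdn_leq|/eqP //].
by rewrite -addnn => /(_ n0); lia.
Qed.

(** As n is even, n + 1 is prime to 2n, and z ^+ n.+1 = - z. *)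
Lemma prim_root_conjugateN (F : numFieldType) (n : nat) (z : F) (p : {poly rat}) :
  (n.*2).-primitive_root z -> ~~ odd n ->
  root (map_poly ratr p) z -> root (map_poly ratr p) (- z).
Proof.
move=> zP n_even pz.
rewrite -mulrN1 -(prim_root_half zP) -exprS.
apply: (prim_root_conjugate zP _ pz).
by rewrite -muln2 coprimeMr coprimeSn coprimen2 /= n_even.
Qed.

(** * Linear equations with cyclotomic coefficients *)

Definition signs : seq (bool * bool * bool) :=
  [seq (s, s') | s <- [seq (s1, s2) | s1 <- [:: false; true], s2 <- [:: false; true]],
                 s' <- [:: false; true]].

Lemma mem_signs s : s \in signs.
Proof. by case: s => [[[] []] []]. Qed.

Lemma split_pow2 D i j k :
  (exists i' j' k', [/\ i = 2 ^ D * i', j = 2 ^ D * j' & k = 2 ^ D * k'])%N \/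
  (exists d i' j' k', [/\ d < D, i = 2 ^ d * i', j = 2 ^ d * j', k = 2 ^ d * k' &
                      (odd i', odd j', odd k') != (false, false, false)])%N.
Proof.
elim: D => [|D [[i' [j' [k' [-> -> ->]]]]|[d [i' [j' [k' [dD ? ? ? ?]]]]]]].
- by left; exists i, j, k; rewrite !mul1n.
- have [[oi oj ok]|N] := eqVneq (odd i', odd j', odd k') (false, false, false).
    left; exists i'./2, j'./2, k'./2; rewrite !expnSr -!mulnA !mul2n.
    by rewrite !even_halfK ?oi ?oj ?ok.
  by right; exists D, i', j', k'; split.
- by right; exists d, i', j', k'; split => //; exact: ltnW.
Qed.

Definition unity_triple (R : pzRingType) (n : nat) (t : R * R * R) : Prop :=
  [/\ t.1.1 ^+ n = 1, t.1.2 ^+ n = 1 & t.2 ^+ n = 1].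

Section Bound.
Variable C : numClosedFieldType.

Local Notation ev p x := ((map_poly (ratr : rat -> C) p).[x]).

Lemma ev_comp (p q : {poly rat}) (x : C) : ev (p \Po q) x = ev p (ev q x).
Proof. by rewrite map_comp_poly horner_comp. Qed.

(** Invariance at x makes the odd part of p vanish there; this is the descent of a value from Q(x)
    to Q(x^2). *)
Lemma ev_even_poly (p : {poly rat}) (x : C) :
  ev p (- x) = ev p x -> ev (even_poly p) (x ^+ 2) = ev p x.
Proof.
have E y : ev p y = ev (even_poly p) (y ^+ 2) + ev (odd_poly p) (y ^+ 2) * y.
  by rewrite -{1}(poly_even_odd p) rmorphD rmorphM /= !hornerE !ev_comp map_polyXn
     map_polyX !hornerE.
rewrite !E sqrrN mulrN => /addrI e.
suff -> : ev (odd_poly p) (x ^+ 2) * x = 0 by rewrite addr0.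
have two0 : 2 != 0 :> C by rewrite pnatr_eq0.
by apply: (mulfI two0); rewrite mulr0 mulr_natl mulr2n -{1}e addNr.
Qed.

(* Conjugate by the automorphism z |-> z ^+ n.+1 = - z of Q(z). *)
Lemma sign_conjugate (n : nat) (z : C) (A0 A1 A2 A3 : {poly rat}) i j k :
  (n.*2).-primitive_root z -> ~~ odd n ->
  ev A0 z + ev A1 z * z ^+ i + ev A2 z * z ^+ j + ev A3 z * z ^+ k = 0 ->
  ev A0 (- z) + ev A1 (- z) * ((-1) ^+ odd i * z ^+ i)
    + ev A2 (- z) * ((-1) ^+ odd j * z ^+ j)
    + ev A3 (- z) * ((-1) ^+ odd k * z ^+ k) = 0.
Proof.
move=> zP n_even e.
have evP (x : C) : ev (A0 + A1 * 'X^i + A2 * 'X^j + A3 * 'X^k) x =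
    ev A0 x + ev A1 x * x ^+ i + ev A2 x * x ^+ j + ev A3 x * x ^+ k.
  by rewrite !rmorphD !rmorphM /= !map_polyXn !(hornerD, hornerM, hornerXn).
have := prim_root_conjugateN (p := A0 + A1 * 'X^i + A2 * 'X^j + A3 * 'X^k) zP n_even.
rewrite /root !evP e eqxx => /(_ isT)/eqP <-.
by rewrite !signr_odd !(exprNn z).
Qed.

(** Each of the 7 nontrivial sign patterns keeps the constant term and negates some coefficient,
    hence gives an independent equation with at most 2 solutions. *)
Lemma covered_sign_classes (a0 a1 a2 a3 : C) :
  a0 != 0 -> a1 != 0 -> a2 != 0 -> a3 != 0 ->
  covered (fun t => nondeg_sol a0 a1 a2 a3 t /\
    exists2 s, s != (false, false, false) &
      a0 + a1 * ((-1) ^+ s.1.1 * t.1.1) + a2 * ((-1) ^+ s.1.2 * t.1.2)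
         + a3 * ((-1) ^+ s.2 * t.2) = 0) 14.
Proof.
move=> a00 a10 a20 a30.
pose r := [seq s <- signs | s != (false, false, false)].
have N (a : C) : a != 0 -> a0 * - a != a0 * a.
  move=> an0; rewrite -subr_eq0 -mulrBr mulf_neq0 // -opprD oppr_eq0 -mulr2n.
  by rewrite -mulr_natl mulf_neq0 // pnatr_eq0.
have := @covered_bigcup _ _ r (fun s t => nondeg_sol a0 a1 a2 a3 t /\
  a0 + (-1) ^+ s.1.1 * a1 * t.1.1 + (-1) ^+ s.1.2 * a2 * t.1.2
         + (-1) ^+ s.2 * a3 * t.2 = 0) 2.
move=> h; apply: covered_sub (h _) => //.
  move=> t [st [s sN e]]; exists s; first by rewrite mem_filter sN mem_signs.
  by split => //; rewrite -e; ring.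
move=> s; rewrite mem_filter => /andP[sN _]; apply: covered_two_linear => //.
case: s sN => [[[] []] []] //= _; rewrite ?expr1 ?expr0 ?mulN1r ?mul1r ?N ?orbT //.
Qed.

Variables (F m : nat) (zeta : C).
Hypothesis F_gt1 : (1 < F)%N.
Hypothesis m_odd : odd m.
Hypothesis zetaP : (2 ^ F * m).-primitive_root zeta.

Let N := (2 ^ F * m)%N.
(** A tower under squaring: [z e] has order 2^e m, [z F] is zeta and [z 0] has the odd order m. *)
Let z e := zeta ^+ (2 ^ (F - e)).

Let z_prim e : (e <= F)%N -> (2 ^ e * m).-primitive_root (z e).
Proof.
move=> eF; have m0 : (0 < m)%N by case: m m_odd.
have dv : (2 ^ e * m %| 2 ^ F * m)%N by rewrite dvdn_pmul2r // dvdn_exp2l.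
have := dvdn_prim_root zetaP dv.
by rewrite divnMr // -expnB.
Qed.

Let zS e : (e < F)%N -> z e.+1 ^+ 2 = z e.
Proof. by move=> eF; rewrite /z -exprM -expnSr subnSK. Qed.

(* For a solution outside the group generated by zeta ^+ (2 ^ D), the exponents
   acquire an odd entry at some 2-adic level above e; there the conjugation
   z |-> - z fixes the coefficients and only changes signs in the solution. *)
Lemma covered_low e D (A0 A1 A2 A3 : {poly rat}) l :
  (e <= F)%N -> (D <= F - e)%N -> (D < F)%N ->
  ev A0 (z e) != 0 -> ev A1 (z e) != 0 -> ev A2 (z e) != 0 -> ev A3 (z e) != 0 ->
  let S := nondeg_sol (ev A0 (z e)) (ev A1 (z e)) (ev A2 (z e)) (ev A3 (z e)) in
  covered (fun t => S t /\ exists i j k, t = (zeta ^+ (2 ^ D) ^+ i,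
    zeta ^+ (2 ^ D) ^+ j, zeta ^+ (2 ^ D) ^+ k)) l ->
  covered (fun t => S t /\ unity_triple N t) (14 + l).
Proof.
move=> eF De DF a00 a10 a20 a30 S cl.
apply: covered_sub (coveredU (covered_sign_classes a00 a10 a20 a30) cl) => //.
move=> [[x y] t] [St [/= xN yN tN]].
have [[i _] /= xi] := prim_rootP zetaP xN.
have [[j _] /= yj] := prim_rootP zetaP yN.
have [[k _] /= tk] := prim_rootP zetaP tN.
have [[i' [j' [k' [Ei Ej Ek]]]]|[d [i' [j' [k' [dD Ei Ej Ek sN]]]]]] := split_pow2 D i j k.
  right; split => //; exists i', j', k'.
  by rewrite xi yj tk Ei Ej Ek !exprM.
left; split => //; exists (odd i', odd j', odd k') => //=.
have [_ _ _ e1 _] := St.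
have E2 : (2 ^ (F - d) * m = (2 ^ (F - d).-1 * m).*2)%N.
  by rewrite -mul2n mulnA -expnS prednK // subn_gt0; exact: ltn_trans DF.
have := z_prim (leq_subr d F); rewrite E2 => wP.
(* Here q is even because d < D <= F - e, so composing with ['X^q] gives coefficients unchanged when
   [z (F - d)] changes sign. *)
pose q := (2 ^ (F - e - d))%N.
have zq : z e = z (F - d) ^+ q.
  by rewrite /z subKn; [rewrite -exprM -expnD subnKC // ltnW //; exact: leq_trans De
                       |rewrite ltnW //; exact: ltn_trans DF].
have q_even : ~~ odd q by rewrite oddX subn_eq0 negb_or -ltnNge (leq_trans dD).
have Ez u : zeta ^+ (2 ^ d * u) = z (F - d) ^+ u.
  by rewrite exprM /z subKn // ltnW //; exact: ltn_trans DF.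
have evq (A : {poly rat}) v : ev (A \Po 'X^q) v = ev A (v ^+ q).
  by rewrite ev_comp map_polyXn hornerXn.
have := @sign_conjugate _ _ (A0 \Po 'X^q) (A1 \Po 'X^q) (A2 \Po 'X^q) (A3 \Po 'X^q)
  i' j' k' wP.
rewrite !evq (exprNn (z _)) -[(-1) ^+ q]signr_odd (negPf q_even) expr0 mul1r -zq.
rewrite -!Ez -Ei -Ej -Ek -xi -yj -tk; apply => //.
(* Since d < D < F, the order of [z (F - d)] is divisible by 4. *)
rewrite oddM m_odd andbT oddX orbF -lt0n.
by move: dD DF; lia.
Qed.

(* Twisting the i-th coordinate by w when its sign is -1 and scaling by
   A0 (- w) makes the coefficients invariant under w |-> - w, hence
   polynomials in w ^+ 2 = z e. *)
Lemma covered_descent e (A0 A1 A2 A3 : {poly rat}) (s : bool * bool * bool) l :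
  (1 < e.+1 <= F)%N ->
  let w := z e.+1 in
  ev A0 w != 0 -> ev A1 w != 0 -> ev A2 w != 0 -> ev A3 w != 0 ->
  ev A0 w * ((-1) ^+ s.1.1 * ev A1 (- w)) = ev A0 (- w) * ev A1 w ->
  ev A0 w * ((-1) ^+ s.1.2 * ev A2 (- w)) = ev A0 (- w) * ev A2 w ->
  ev A0 w * ((-1) ^+ s.2 * ev A3 (- w)) = ev A0 (- w) * ev A3 w ->
  (forall B0 B1 B2 B3 : {poly rat}, ev B0 (z e) != 0 -> ev B1 (z e) != 0 ->
    ev B2 (z e) != 0 -> ev B3 (z e) != 0 ->
    covered (fun t => nondeg_sol (ev B0 (z e)) (ev B1 (z e)) (ev B2 (z e)) (ev B3 (z e)) t
                      /\ unity_triple N t) l) ->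
  covered (fun t => nondeg_sol (ev A0 w) (ev A1 w) (ev A2 w) (ev A3 w) t /\ unity_triple N t) l.
Proof.
move=> /andP[e1 eF] w a00 a10 a20 a30 h1 h2 h3 IH.
have wP : (2 ^ e * m).*2.-primitive_root w.
  by have := z_prim eF; rewrite expnS -mulnA mul2n.
have e_even : ~~ odd (2 ^ e * m) by rewrite oddM oddX; move: e1; case: (e).
have w1 : `|w| = 1 by exact: norm_prim_root wP.
have w0 : w != 0 by exact: unim_neq0.
have wN : w ^+ N = 1 by rewrite /w /z -exprM mulnC exprM (prim_expr_order zetaP : _ ^+ N = _) expr1n.
pose B (A : {poly rat}) (b : bool) := even_poly (A * 'X^b * (A0 \Po - 'X)).
pose d0 := ev A0 (- w).
(* A zero of [A0] at - w would be conjugated back to one at w. *)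
have d00 : d0 != 0.
  have wP' : (2 ^ e * m).*2.-primitive_root (- w).
    rewrite -mulrN1 -(prim_root_half wP) -exprS.
    by rewrite prim_root_exp_coprime // -muln2 coprimeMr coprimeSn coprimen2 /= e_even.
  apply: contraNneq a00 => dz; have := prim_root_conjugateN (p := A0) wP' e_even.
  by rewrite /root opprK -/d0 dz; apply.
have evX (A : {poly rat}) (b : bool) x : ev (A * 'X^b * (A0 \Po - 'X)) x =
    ev A x * x ^+ b * ev A0 (- x).
  by rewrite !rmorphM /= map_polyXn !hornerM hornerXn ev_comp rmorphN /= map_polyX
     hornerN hornerX.
have evB A (b : bool) : ev A0 w * ((-1) ^+ b * ev A (- w)) = d0 * ev A w ->
    ev (B A b) (z e) = d0 * (ev A w * w ^+ b).
  move=> h; rewrite -(zS eF) ev_even_poly.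
    by rewrite evX mulrC.
  rewrite !evX opprK exprNn.
  have -> : ev A (- w) * ((-1) ^+ b * w ^+ b) * ev A0 w =
     ev A0 w * ((-1) ^+ b * ev A (- w)) * w ^+ b by ring.
  by rewrite h /d0; ring.
have E0 : ev (B A0 false) (z e) = d0 * ev A0 w.
  by rewrite evB ?expr0 ?mulr1 // mul1r mulrC.
have wb (b : bool) : w ^+ b != 0 by exact: (expf_neq0 b w0).
have WN (a : C) (b : bool) : a != 0 -> d0 * (a * w ^+ b) != 0.
  by move=> an0; exact: mulf_neq0 d00 (mulf_neq0 an0 (wb b)).
have := IH (B A0 false) (B A1 s.1.1) (B A2 s.1.2) (B A3 s.2).
rewrite E0 !evB // (mulf_neq0 d00 a00) !WN // => /(_ isT isT isT isT).
apply: (@covered_image _ _ (fun t => (w ^+ s.1.1 * t.1.1, w ^+ s.1.2 * t.1.2,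
                                      w ^+ s.2 * t.2))).
move=> [[x y] u] [[x1 y1 u1 eS [n1 n2 n3]] [/= xN yN uN]].
have wbN (b : bool) : (w ^+ b) ^+ N = 1 by rewrite exprAC wN expr1n.
exists (x / w ^+ s.1.1, y / w ^+ s.1.2, u / w ^+ s.2); last first.
  by rewrite /= !(mulrC (w ^+ _)) !divfK.
have M (a v : C) (b : bool) : d0 * (a * w ^+ b) * (v / w ^+ b) = d0 * (a * v).
  by rewrite -!mulrA mulrCA [w ^+ b * _]mulrCA divff // mulr1; ring.
split; last by split; rewrite /= exprMn exprVn wbN invr1 mulr1.
have wb1 (b : bool) : `|w ^+ b| = 1 by rewrite normrX w1 expr1n.
rewrite /nondeg_sol !normrM !normfV !wb1 invr1 !mulr1 !M.
by rewrite -!mulrDr eS mulr0 !mulf_neq0.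
Qed.

(** As [z 1] has order 2m, its m-th power is -1 and its square is [z 0]; so levels 0 and 1 carry the
    same field. *)
Lemma z1E : z 1 = - z 0 ^+ (m.+1)./2.
Proof.
rewrite -(zS (ltnW F_gt1)) -exprM mul2n even_halfK /= ?m_odd //.
have zP := z_prim (ltnW F_gt1); rewrite expn1 mul2n in zP.
by rewrite exprS (prim_root_half zP) mulrN1 opprK.
Qed.

(* A low solution is a sign times a root of odd order, and v |-> v ^+ 2 induces
   an automorphism squaring the roots of odd order. *)
Lemma covered_odd_level (A0 A1 A2 A3 : {poly rat}) :
  ev A0 (z 0) != 0 -> ev A1 (z 0) != 0 -> ev A2 (z 0) != 0 -> ev A3 (z 0) != 0 ->
  covered (fun t => nondeg_sol (ev A0 (z 0)) (ev A1 (z 0)) (ev A2 (z 0)) (ev A3 (z 0)) t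
                    /\ unity_triple N t) 110.
Proof.
move=> a00 a10 a20 a30; pose h := (m.+1)./2.
have h2 : (2 * h = m.+1)%N by rewrite mul2n even_halfK //= m_odd.
have vP : m.-primitive_root (z 0) by have := z_prim (leq0n F); rewrite mul1n.
have v2P : m.-primitive_root (z 0 ^+ 2) by rewrite prim_root_exp_coprime // coprime2n.
(* The h-th power undoes squaring, as 2h = m + 1. *)
have frob_neq0 (A : {poly rat}) : ev A (z 0) != 0 -> ev A (z 0 ^+ 2) != 0.
  apply: contraNneq => Az.
  have hm : coprime h m by have := coprimeSn m; rewrite -h2 coprimeMl => /andP[].
  have := prim_root_conjugate (p := A) v2P hm.
  rewrite /root Az eqxx -exprM h2 exprS prim_expr_order // mulr1.
  by move/(_ isT).
(* With D = F - 1 the low solutions are powers of [z 1], that is, signed powers of [z 0]. The count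
   is 14 + 96, with 96 = 8 * 12 over the sign patterns. *)
apply: (@covered_low 0 F.-1 _ _ _ _ 96) => //; try by move: F_gt1; lia.
have Ew : zeta ^+ (2 ^ F.-1) = - z 0 ^+ h by rewrite -z1E /z subn1.
rewrite Ew; set v := z 0 in a00 a10 a20 a30 vP v2P frob_neq0 *.
clearbody v.
have := @covered_bigcup _ _ signs (fun s t =>
  [/\ nondeg_sol (ev A0 v) (ev A1 v) (ev A2 v) (ev A3 v) t &
   exists i j k, t = ((-1) ^+ s.1.1 * v ^+ i, (-1) ^+ s.1.2 * v ^+ j,
                      (-1) ^+ s.2 * v ^+ k)]) 12.
move=> cl; apply: covered_sub (cl _) => //.
  move=> t [St [i [j [k Et]]]]; exists (odd i, odd j, odd k); first exact: mem_signs.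
  split => //; exists (h * i)%N, (h * j)%N, (h * k)%N.
  by rewrite Et /= !signr_odd !exprM; do ![rewrite (exprNn (v ^+ h))].
move=> s _.
have SN (b : bool) (a : C) : a != 0 -> (-1) ^+ b * a != 0.
  by move=> an0; rewrite mulf_neq0 ?signr_eq0.
have sgK (b : bool) : (-1) ^+ b * (-1) ^+ b = 1 :> C by rewrite -expr2 sqrr_sign.
(* The signs move into the coefficients; the automorphism fixes them and squares the odd-order
   factors. *)
have := covered_linear_quadric (b0 := ev A0 v) (b1 := (-1) ^+ s.1.1 * ev A1 v)
  (b2 := (-1) ^+ s.1.2 * ev A2 v) (b3 := (-1) ^+ s.2 * ev A3 v)
  (d0 := ev A0 (v ^+ 2)) (d1 := (-1) ^+ s.1.1 * ev A1 (v ^+ 2))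
  (d2 := (-1) ^+ s.1.2 * ev A2 (v ^+ 2)) (d3 := (-1) ^+ s.2 * ev A3 (v ^+ 2)).
move=> /(_ a00 (SN _ _ a10) (SN _ _ a20) (SN _ _ a30) (frob_neq0 _ a00)
  (SN _ _ (frob_neq0 _ a10)) (SN _ _ (frob_neq0 _ a20)) (SN _ _ (frob_neq0 _ a30))).
apply: (@covered_image _ _ (fun t => ((-1) ^+ s.1.1 * t.1.1, (-1) ^+ s.1.2 * t.1.2,
                                      (-1) ^+ s.2 * t.2))).
move=> t [St [i [j [k Et]]]]; move: St; rewrite Et => -[_ _ _ eS n123].
exists (v ^+ i, v ^+ j, v ^+ k) => //=.
have M (b : bool) (a x : C) : (-1) ^+ b * a * x = a * ((-1) ^+ b * x) by ring.
rewrite /nondeg_sol !M; split.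
  by split; rewrite ?normrX ?(norm_prim_root vP) ?expr1n.
pose P := A0 + A1 * ((-1) ^+ s.1.1 * 'X^i) + A2 * ((-1) ^+ s.1.2 * 'X^j)
            + A3 * ((-1) ^+ s.2 * 'X^k).
have evP (x : C) : ev P x = ev A0 x + ev A1 x * ((-1) ^+ s.1.1 * x ^+ i)
   + ev A2 x * ((-1) ^+ s.1.2 * x ^+ j) + ev A3 x * ((-1) ^+ s.2 * x ^+ k).
  have sgE (b : bool) : ((-1) ^+ b : {poly C}).[x] = (-1) ^+ b.
    by case: b; rewrite ?expr1 ?hornerN hornerC.
  by rewrite !rmorphD !rmorphM /= !map_polyXn !rmorph_sign
             !(hornerD, hornerM, hornerXn) !sgE.
have := prim_root_conjugate (p := P) vP (s := 2).
rewrite coprime2n m_odd /root !evP eS eqxx => /(_ isT isT)/eqP.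
by rewrite -!(exprAC v 2).
Qed.

(** Induction on e from the odd level. Either some sign pattern makes the conjugate equation
    proportional to the given one, and the coefficients descend, or all 8 patterns give independent
    equations, and the count is at most 14 + 8 * 2. *)
Lemma covered_cyclotomic e (A0 A1 A2 A3 : {poly rat}) : (e <= F)%N ->
  ev A0 (z e) != 0 -> ev A1 (z e) != 0 -> ev A2 (z e) != 0 -> ev A3 (z e) != 0 ->
  covered (fun t => nondeg_sol (ev A0 (z e)) (ev A1 (z e)) (ev A2 (z e)) (ev A3 (z e)) t
                    /\ unity_triple N t) 110.
Proof.
elim: e A0 A1 A2 A3 => [|[|e] IH] A0 A1 A2 A3 eF; first exact: covered_odd_level.
  have E (A : {poly rat}) : ev A (z 1) = ev (A \Po - 'X^((m.+1)./2)) (z 0).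
    by rewrite ev_comp rmorphN /= map_polyXn hornerN hornerXn z1E.
  by rewrite !E; exact: covered_odd_level.
set w := z e.+2 => a00 a10 a20 a30.
have eF' : (1 < e.+2 <= F)%N by rewrite eF.
pose prop (s : bool * bool * bool) :=
  [&& ev A0 w * ((-1) ^+ s.1.1 * ev A1 (- w)) == ev A0 (- w) * ev A1 w,
      ev A0 w * ((-1) ^+ s.1.2 * ev A2 (- w)) == ev A0 (- w) * ev A2 w &
      ev A0 w * ((-1) ^+ s.2 * ev A3 (- w)) == ev A0 (- w) * ev A3 w].
have [/hasP[s _ /and3P[/eqP p1 /eqP p2 /eqP p3]]|/hasPn nprop] := boolP (has prop signs).
  apply: (covered_descent eF' a00 a10 a20 a30 p1 p2 p3) => B0 B1 B2 B3.
  by apply: IH; exact: ltnW.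
apply: (@covered_le _ _ (14 + 16)) => //.
(* This D makes [zeta ^+ (2 ^ D)] equal to w. *)
apply: (@covered_low e.+2 (F - e.+2) _ _ _ _ 16) => //; first by move: eF; lia.
rewrite -[zeta ^+ _]/w.
have := @covered_bigcup _ _ signs (fun s t =>
  [/\ nondeg_sol (ev A0 w) (ev A1 w) (ev A2 w) (ev A3 w) t &
   ev A0 (- w) + (-1) ^+ s.1.1 * ev A1 (- w) * t.1.1
     + (-1) ^+ s.1.2 * ev A2 (- w) * t.1.2
     + (-1) ^+ s.2 * ev A3 (- w) * t.2 = 0]) 2.
move=> cl; apply: covered_sub (cl _) => //.
  move=> t [St [i [j [k Et]]]]; exists (odd i, odd j, odd k); first exact: mem_signs.
  split => //; move: (St); rewrite Et => -[_ _ _ eS _].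
  have wP : (2 ^ e.+1 * m).*2.-primitive_root w.
    by have := z_prim eF; rewrite expnS -mulnA mul2n.
  have e_even : ~~ odd (2 ^ e.+1 * m) by rewrite oddM oddX.
  by rewrite -[RHS](sign_conjugate wP e_even eS) /=; ring.
move=> s /nprop; rewrite !negb_and => Ns.
exact: covered_two_linear.
Qed.

End Bound.

(** * Linear equations with arbitrary coefficients *)

(** Explicit and over any ring, so that it applies to polynomials over [rat] and commutes with
    evaluation. *)
Definition det3 (R : pzRingType) (c d e : R * R * R) : R :=
  c.1.1 * (d.1.2 * e.2 - d.2 * e.1.2) - c.1.2 * (d.1.1 * e.2 - d.2 * e.1.1)
  + c.2 * (d.1.1 * e.1.2 - d.1.2 * e.1.1).

Section Unity.
Variable C : numClosedFieldType.

(** Cramer's rule for a0, a1, a2 in terms of a3; each triple collects one coordinate of three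
    solutions. *)
Lemma plane_cramer (a0 a1 a2 a3 : C) (x y z : C * C * C) :
  a0 + a1 * x.1.1 + a2 * y.1.1 + a3 * z.1.1 = 0 ->
  a0 + a1 * x.1.2 + a2 * y.1.2 + a3 * z.1.2 = 0 ->
  a0 + a1 * x.2 + a2 * y.2 + a3 * z.2 = 0 ->
  [/\ a0 * det3 (1, 1, 1) x y = - a3 * det3 z x y,
      a1 * det3 (1, 1, 1) x y = - a3 * det3 (1, 1, 1) z y &
      a2 * det3 (1, 1, 1) x y = - a3 * det3 (1, 1, 1) x z].
Proof.
move=> e1 e2 e3.
have E : forall k1 k2 k3 : C, 0 =
    k1 * (a0 + a1 * x.1.1 + a2 * y.1.1 + a3 * z.1.1)
  + k2 * (a0 + a1 * x.1.2 + a2 * y.1.2 + a3 * z.1.2)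
  + k3 * (a0 + a1 * x.2 + a2 * y.2 + a3 * z.2).
  by move=> *; rewrite e1 e2 e3 !mulr0 !addr0.
rewrite /det3 /=; split; apply/eqP; rewrite -subr_eq0; apply/eqP.
- rewrite [RHS](E (x.1.2 * y.2 - x.2 * y.1.2) (x.2 * y.1.1 - x.1.1 * y.2)
                  (x.1.1 * y.1.2 - x.1.2 * y.1.1)); ring.
- rewrite [RHS](E (y.1.2 - y.2) (y.2 - y.1.1) (y.1.1 - y.1.2)); ring.
- rewrite [RHS](E (x.2 - x.1.2) (x.1.1 - x.2) (x.1.2 - x.1.1)); ring.
Qed.

(** If any three solutions are dependent in (1, x, y), the line through two of them is a second
    linear equation, unless all share x and y, which determine z. Otherwise Cramer's rule puts a
    multiple of the coefficients in Q(zeta). *)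
Lemma covered_unity_sol (n : nat) (a0 a1 a2 a3 : C) : (0 < n)%N ->
  a0 != 0 -> a1 != 0 -> a2 != 0 -> a3 != 0 ->
  covered (fun t => nondeg_sol a0 a1 a2 a3 t /\
    unity_triple n t) 110.
Proof.
move=> n0 a00 a10 a20 a30; set S := (fun t => _).
pose X (t : C * C * C) := t.1.1; pose Y (t : C * C * C) := t.1.2.
have [[u [v [w [Su Sv Sw D0]]]]|dep] := EM (exists u v w, [/\ S u, S v, S w &
    det3 (1, 1, 1) (X u, X v, X w) (Y u, Y v, Y w) != 0]); last first.
  have det0 u v w : S u -> S v -> S w ->
      det3 (1, 1, 1) (X u, X v, X w) (Y u, Y v, Y w) = 0.
    by move=> Su Sv Sw; apply/eqP/negPn/negP => D0; apply: dep; exists u, v, w.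
  have [[u [v [Su Sv uv]]]|const] := EM (exists u v, [/\ S u, S v &
      (X u, Y u) != (X v, Y v)]).
    pose b0 := X u * Y v - X v * Y u.
    have nprop : [|| a0 * (Y u - Y v) != b0 * a1, a0 * (X v - X u) != b0 * a2 |
                     a0 * 0 != b0 * a3].
      have [->|b00] := eqVneq b0 0; last first.
        by rewrite mulr0 [0 == _]eq_sym (mulf_neq0 b00 a30) !orbT.
      rewrite !mul0r mulr0 eqxx !mulf_eq0 (negPf a00) !subr_eq0 orbF.
      by apply: contraNT uv; rewrite negb_or !negbK => /andP[/eqP-> /eqP->].
    apply: covered_sub (covered_two_linear a00 a10 a20 a30 nprop) => // t St.
    split; first by case: St.
    by rewrite -[RHS](det0 u v t Su Sv St) /det3 /b0 /=; ring.
  have [[u Su]|none] := EM (exists u, S u); last first.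
    by apply: covered_none => t St; apply: none; exists t.
  exists [:: u] => // t St; rewrite inE.
  have [ex ey] : X u = X t /\ Y u = Y t.
    suff /eqP[-> ->] : (X u, Y u) == (X t, Y t) by [].
    by apply/negPn/negP => ut; apply: const; exists u, t.
  move: u t Su St ex ey => [[x y] z] [[x' y'] z'] /= [[_ _ _ e _] _] [[_ _ _ e' _] _].
  rewrite /X /Y /= => ex ey; subst x' y'.
  by move: e'; rewrite -e => /addrI/(mulfI a30) ->.
have [m m_odd En] := pfactor_coprime (isT : prime 2) n0.
rewrite coprime2n in m_odd; set f := logn 2 n in En.
(* The order 4n has exponent of 2 above 1 even when n is odd. *)
have N0 : (2 ^ f.+2 * m)%:R != 0 :> C.
  by rewrite pnatr_eq0 muln_eq0 negb_or expn_eq0 /=; case: m m_odd {En}.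
have [zeta zetaP] := prim_root_exists N0.
have SN (x : C) : x ^+ n = 1 -> x ^+ (2 ^ f.+2 * m) = 1.
  have -> : (2 ^ f.+2 * m = n * 4)%N by rewrite En !expnS; lia.
  by rewrite exprM => ->; rewrite expr1n.
have exps t : S t -> exists k : nat * nat * nat,
    t = (zeta ^+ k.1.1, zeta ^+ k.1.2, zeta ^+ k.2).
  case: t => [[x y] z] [_ [/= /SN xN /SN yN /SN zN]].
  have [i ->] := prim_rootP zetaP xN; have [j ->] := prim_rootP zetaP yN.
  by have [k ->] := prim_rootP zetaP zN; exists (nat_of_ord i, nat_of_ord j, nat_of_ord k).
have [ku Eu] := exps _ Su; have [kv Ev] := exps _ Sv; have [kw Ew] := exps _ Sw.
pose pX (i j k : nat) : {poly rat} * {poly rat} * {poly rat} := ('X^i, 'X^j, 'X^k).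
pose px := pX ku.1.1 kv.1.1 kw.1.1; pose py := pX ku.1.2 kv.1.2 kw.1.2.
pose pz := pX ku.2 kv.2 kw.2.
pose h (p : {poly rat}) : C := (map_poly ratr p).[zeta].
have h_det i j k i' j' k' i'' j'' k'' :
    h (det3 (pX i j k) (pX i' j' k') (pX i'' j'' k'')) =
    det3 (zeta ^+ i, zeta ^+ j, zeta ^+ k) (zeta ^+ i', zeta ^+ j', zeta ^+ k')
         (zeta ^+ i'', zeta ^+ j'', zeta ^+ k'').
  by rewrite /h /det3 !(rmorphD, rmorphN, rmorphM) /= !map_polyXn
             !(hornerD, hornerN, hornerM, hornerXn).
(* Polynomial lifts of Cramer's determinants: their values at zeta are proportional to the
   coefficients a_i. *)
pose A0 := - det3 pz px py; pose A1 := - det3 (pX 0 0 0)%N pz py.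
pose A2 := - det3 (pX 0 0 0)%N px pz; pose A3 := det3 (pX 0 0 0)%N px py.
have [c0 c1 c2] : [/\ a0 * h A3 = a3 * h A0, a1 * h A3 = a3 * h A1 &
                      a2 * h A3 = a3 * h A2].
  have hN p : h (- p) = - h p by rewrite /h rmorphN hornerN.
  rewrite !hN !mulrN -!mulNr !h_det expr0; apply: plane_cramer.
  - by case: Su => + _; rewrite Eu => -[].
  - by case: Sv => + _; rewrite Ev => -[].
  - by case: Sw => + _; rewrite Ew => -[].
have A30 : h A3 != 0.
  by rewrite h_det expr0; move: D0; rewrite Eu Ev Ew.
pose c := h A3 / a3.
have c00 : c != 0 by rewrite mulf_neq0 ?invr_eq0.
have {}c0 : h A0 = c * a0 by rewrite /c mulrAC -[h A3 * _]mulrC c0 mulrC mulKf.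
have {}c1 : h A1 = c * a1 by rewrite /c mulrAC -[h A3 * _]mulrC c1 mulrC mulKf.
have {}c2 : h A2 = c * a2 by rewrite /c mulrAC -[h A3 * _]mulrC c2 mulrC mulKf.
have c3 : h A3 = c * a3 by rewrite /c mulfVK.
clearbody c.
have := @covered_cyclotomic C f.+2 m zeta isT m_odd zetaP f.+2 A0 A1 A2 A3 (leqnn _).
rewrite /= subnn expn0 expr1 -!/(h _) c0 c1 c2 c3.
move=> /(_ (mulf_neq0 c00 a00) (mulf_neq0 c00 a10) (mulf_neq0 c00 a20)
  (mulf_neq0 c00 a30)); apply: covered_sub => //.
move=> [[x y] z] [[x1 y1 z1 e [n1 n2 n3]] [/= /SN ? /SN ? /SN ?]]; split; last by split.
rewrite /nondeg_sol -!mulrA -!mulrDr e mulr0; split => //.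
by split; exact: mulf_neq0.
Qed.

End Unity.

(** * The arrangement induced on a plane *)

Section FsetSet.
Variables (T : choiceType) (A : set T).

Lemma size_le_card_fset_set (s : seq T) : finite_set A -> uniq s ->
  (forall x, x \in s -> A x) -> (size s <= #|` fset_set A|%fset)%N.
Proof.
move=> finA us sA; apply: uniq_leq_size => // x /sA Ax.
by rewrite in_fset_set // mem_set.
Qed.

Lemma card_fset_set_le_size (s : seq T) :
  (forall x, A x -> x \in s) -> (#|` fset_set A|%fset <= size s)%N.
Proof.
move=> As; have finA : finite_set A.
  by apply: (@sub_finite_set _ _ [set` s]); last exact: finite_seq.
apply: uniq_leq_size; first exact: fset_uniq.
by move=> x; rewrite in_fset_set // => /set_mem /As.
Qed.

End FsetSet.

(** * The brackets as perfect matchings of the four indices *)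

Definition paired (b : 'I_3) (i j : 'I_4) : bool :=
  ((i, j) \in bracket b) || ((j, i) \in bracket b).

(** Forgets the order in which a bracket lists its two pairs, so that all blocks and indices are
    treated alike. *)
Definition bracket_quad (b : 'I_3) (i j k l : 'I_4) : bool :=
  [&& uniq [:: i; j; k; l], paired b i j, paired b k l &
      all (fun h => h \in [:: (i, j); (j, i); (k, l); (l, k)]) (bracket b)].

Lemma partner_exists b i : exists j k l, bracket_quad b i j k l.
Proof.
pose pr1 := nth (i, i) (bracket b) 0; pose pr2 := nth (i, i) (bracket b) 1.
pose pr := if (i == pr1.1) || (i == pr1.2) then (pr1, pr2) else (pr2, pr1).
exists (if i == pr.1.1 then pr.1.2 else pr.1.1), pr.2.1, pr.2.2.
rewrite /pr /pr1 /pr2.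
by case: b pr1 pr2 pr => [[|[|[|//]]] ?]; case: i => [[|[|[|[|//]]]] ?].
Qed.

Lemma pair_block_exists i j : i != j -> exists b k l, bracket_quad b i j k l.
Proof.
move=> ij.
pose b := if paired (@Ordinal 3 0 isT) i j then @Ordinal 3 0 isT else
          if paired (@Ordinal 3 1 isT) i j then @Ordinal 3 1 isT else @Ordinal 3 2 isT.
pose pr1 := nth (i, j) (bracket b) 0; pose pr2 := nth (i, j) (bracket b) 1.
pose pr := if (i == pr1.1) || (i == pr1.2) then pr2 else pr1.
exists b, pr.1, pr.2; move: ij; rewrite /pr /pr1 /pr2 /b {b pr1 pr2 pr}.
by case: i => [[|[|[|[|//]]]] ?]; case: j => [[|[|[|[|//]]]] ?].
Qed.

Lemma sum_bracket_quad (M : nmodType) (f : 'I_4 -> M) b i j k l :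
  bracket_quad b i j k l -> \sum_h f h = f i + f j + f k + f l.
Proof.
case/and4P => u _ _ _.
rewrite -(big_enum _ _ _ f) (perm_big [:: i; j; k; l]) /=.
  by rewrite !big_cons big_nil addr0 !addrA.
apply: uniq_perm => //; first exact: enum_uniq.
have sub : {subset [:: i; j; k; l] <= enum 'I_4} by move=> h _; rewrite mem_enum.
by have [|_ e h] := uniq_min_size u sub; rewrite ?size_enum_ord.
Qed.

(** A complement of H is a line; a nonzero coordinate of the projection onto it along H is a linear
    form with kernel H. *)
Lemma hyperplane_equation (K : fieldType) (m : nat) (H : {vspace 'rV[K]_m.+1}) :
  \dim H = m -> exists a : 'I_m.+1 -> K,
    forall x : 'rV_m.+1, (x \in H) = (\sum_i a i * x 0 i == 0).
Proof.
move=> dH; have dHC : \dim H^C = 1.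
  by rewrite dimv_compl dH dimvf /dim /= mul1n subSnn.
have cap : (H^C :&: H = 0)%VS by rewrite capvC capv_compl.
pose pr := daddv_pi H^C H.
have prH x : (pr x == 0) = (x \in H).
  have Dx : pr x + daddv_pi H H^C x = x.
    by rewrite daddv_pi_add // addvC addv_complf memvf.
  apply/eqP/idP => [p0|xH]; first by rewrite -Dx p0 add0r memv_pi.
  apply/eqP; rewrite -memv0 -cap memv_cap memv_pi -(addrK (daddv_pi H H^C x) (pr x)).
  by rewrite Dx rpredB // memv_pi.
pose v := vpick (H^C)%VS.
have vN0 : v != 0 by rewrite vpick0 -dimv_eq0 dHC.
have vE : (H^C = <[v]>)%VS.
  apply/esym/eqP; rewrite eqEdim -memvE memv_pick dim_vline vN0 dHC //.
have [h vh] : exists h, v 0 h != 0.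
  apply/existsP; apply: contraNT vN0; rewrite negb_exists => /forallP v0.
  by apply/eqP/rowP => h; rewrite mxE; apply/eqP; have := v0 h; rewrite negbK.
exists (fun i => pr (delta_mx 0 i) 0 h) => x; rewrite -prH.
have -> : \sum_i pr (delta_mx 0 i) 0 h * x 0 i = pr x 0 h.
  rewrite {2}(row_sum_delta x) linear_sum summxE; apply: eq_bigr => i _.
  by rewrite linearZ mxE mulrC.
have : pr x \in (H^C)%VS by exact: memv_pi.
rewrite vE => /vlineP[c ->]; rewrite mxE scaler_eq0 mulf_eq0 (negPf vN0) (negPf vh) //.
Qed.

(* Rewriting with [mem_coord_plane] in a goal with two membership tests makes
   unification unfold both, hence the explicit transitivity steps below. *)
Lemma coord_plane_eqP (R : realType) (i j k l : 'I_4) (z w : complex R) :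
  coord_plane i j z = coord_plane k l w <->
  forall x : V4 R, (x 0 i == z * x 0 j) = (x 0 k == w * x 0 l).
Proof.
split=> [e x|h].
  have m := mem_coord_plane i j z x; rewrite e in m.
  exact: etrans (esym m) (mem_coord_plane k l w x).
apply/vspaceP => x; have m := mem_coord_plane i j z x; rewrite h in m.
exact: etrans m (esym (mem_coord_plane k l w x)).
Qed.

Definition basis_vec (R : realType) (i : 'I_4) : V4 R := delta_mx 0 i.

Definition affine_vec (R : realType) (t : complex R * complex R * complex R) : V4 R :=
  \row_i [:: 1; t.1.1; t.1.2; t.2]`_i.

Section Geometry.
Variables (R : realType) (n : nat) (H : {vspace V4 R}).
Notation C := (complex R).
Hypothesis n_gt3 : (3 < n)%N.

Let n_gt0 : (0 < n)%N. Proof. exact: leq_trans n_gt3. Qed.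

Lemma root1_neq0 (z : C) : z ^+ n = 1 -> z != 0.
Proof.
move=> zn; apply/eqP => z0; have /eqP := zn.
by rewrite z0 expr0n gtn_eqF // eq_sym oner_eq0.
Qed.

Lemma coord_planeC (i j : 'I_4) (z : C) : z != 0 ->
  coord_plane i j z = coord_plane j i z^-1.
Proof.
move=> z0; apply/coord_plane_eqP => x; apply/eqP/eqP => ->; first by rewrite mulKf.
by rewrite mulVKf.
Qed.

Lemma paired_block b i j (z : C) :
  paired b i j -> z ^+ n = 1 -> block n b (coord_plane i j z).
Proof.
move=> /orP[ij|ji] zn; first by exists i, j, z.
rewrite coord_planeC ?root1_neq0 //; exists j, i, z^-1; split => //.
by rewrite exprVn zn invr1.
Qed.

Lemma block_quad b i j k l (L : {vspace V4 R}) :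
  bracket_quad b i j k l -> block n b L ->
  exists2 z : C, z ^+ n = 1 & L = coord_plane i j z \/ L = coord_plane k l z.
Proof.
case/and4P => _ _ _ /allP br [i' [j' [z [/br]]]].
have V (w : C) : w ^+ n = 1 -> w^-1 ^+ n = 1 by move=> wn; rewrite exprVn wn invr1.
rewrite !inE => /or4P[] /eqP[-> ->] zn ->.
- by exists z; [|left].
- by exists z^-1; [exact: V|left; rewrite -coord_planeC ?root1_neq0].
- by exists z; [|right].
- by exists z^-1; [exact: V|right; rewrite -coord_planeC ?root1_neq0].
Qed.

Lemma coord_plane_inj i j : i != j -> injective (@coord_plane R i j).
Proof.
move=> ij z w /coord_plane_eqP /(_ (z *: delta_mx 0 i + delta_mx 0 j)).
rewrite !mxE !eqxx (negPf ij) [j == i]eq_sym (negPf ij) /=.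
rewrite !(mulr1, mulr0, addr0, add0r) eqxx => /esym/eqP ->.
by rewrite ?mulr1.
Qed.

Lemma unity_roots : exists rs : seq C,
  [/\ size rs = n, uniq rs & forall z, (z \in rs) = (z ^+ n == 1)].
Proof.
have [w wP] : exists w : C, n.-primitive_root w.
  by apply: prim_root_exists; rewrite pnatr_eq0 -lt0n.
exists [seq w ^+ i | i <- iota 0 n]; split; first by rewrite size_map size_iota.
  rewrite map_inj_in_uniq ?iota_uniq // => i j; rewrite !mem_iota /= => ilt jlt.
  by move/eqP; rewrite (eq_prim_root_expr wP) !modn_small // => /eqP.
move=> z; apply/mapP/eqP => [[i _ ->]|/(prim_rootP wP)[i ->]].
  by rewrite exprAC (prim_expr_order wP) expr1n.
by exists (val i); rewrite // mem_iota /=.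
Qed.

Let through b (p : V4 R) : set {vspace V4 R} :=
  [set L | block n b L /\ (<[p]> <= L)%VS].

Let finite_through b p : finite_set (through b p).
Proof. by apply: sub_finite_set (finite_block R b n_gt0) => L []. Qed.

Lemma card_through_ge b i j (p : V4 R) : i != j -> paired b i j -> p 0 i = 0 -> p 0 j = 0 ->
  (n <= #|` fset_set (through b p)|%fset)%N.
Proof.
move=> ij bij pi pj; have [rs [srs urs rsP]] := unity_roots.
have := @size_le_card_fset_set _ (through b p) (map (@coord_plane R i j) rs).
rewrite size_map srs (map_inj_uniq (coord_plane_inj ij)).
apply; [exact: finite_through|exact: urs|].
move=> _ /mapP[z + ->]; rewrite rsP => /eqP zn; split; first exact: (paired_block bij zn).
by rewrite -memvE mem_coord_plane pi pj mulr0.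
Qed.

Lemma basis_vec_neq0 i : basis_vec R i != 0.
Proof. by apply/eqP => /rowP/(_ i)/eqP; rewrite !mxE !eqxx oner_eq0. Qed.

(** In each block, if i is paired with j and k with l, the vertex lies on the n planes for k, l and
    on none for i, j. Excluding such points makes every coefficient of H nonzero. *)
Lemma basis_point_mult i : basis_vec R i \in H ->
  points_of_mult n H n <[basis_vec R i]>%VS.
Proof.
move=> eiH; split.
  split; first by rewrite dim_vline basis_vec_neq0.
    by rewrite -memvE.
  have [j1 [k1 [l1 q1]]] := partner_exists (@Ordinal 3 0 isT) i.
  have [j2 [k2 [l2 q2]]] := partner_exists (@Ordinal 3 1 isT) i.
  exists (@Ordinal 3 0 isT), (@Ordinal 3 1 isT).
  exists (coord_plane k1 l1 1%R :&: H)%VS, (coord_plane k2 l2 1%R :&: H)%VS.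
  have On b j k l : bracket_quad b i j k l ->
      line n H b (coord_plane k l 1%R :&: H)%VS /\
      (<[basis_vec R i]> <= coord_plane k l 1%R :&: H)%VS.
    case/and4P; rewrite /= !inE !negb_or => /and4P[/and3P[_ ik il] _ _ _] _ bkl _.
    split; first by exists (coord_plane k l 1) => //; apply: paired_block; rewrite ?expr1n.
    rewrite -memvE memv_cap eiH mem_coord_plane !mxE [k == i]eq_sym [l == i]eq_sym.
    by rewrite (negPf ik) (negPf il) !andbF mulr0 eqxx.
  have [h1 h1'] := On _ _ _ _ q1; have [h2 h2'] := On _ _ _ _ q2.
  exact: And5 isT h1 h2 h1' h2'.
move=> b; have [j [k [l q]]] := partner_exists b i.
have := q; case/and4P; rewrite /= !inE !negb_or.
move=> /and4P[/and3P[ij ik il] _ kl _] bij bkl _.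
apply/eqP; rewrite eqn_leq; apply/andP; split; last first.
  apply: (card_through_ge kl bkl); rewrite !mxE eq_sym ?(negPf ik) ?(negPf il) //.
have [rs [srs urs rsP]] := unity_roots.
have := @card_fset_set_le_size _ (through b (basis_vec R i)) (map (@coord_plane R k l) rs).
rewrite size_map srs; apply.
move=> L [/(block_quad q)[z zn [->|->]]].
  rewrite -memvE mem_coord_plane !mxE !eqxx [j == i]eq_sym (negPf ij) /= mulr0.
  by rewrite oner_eq0.
by move=> _; apply: map_f; rewrite rsP zn.
Qed.

(** As 2 < n, paired coordinates do not both vanish, so each pair of indices has at most one plane
    through p; two planes thus force one for i, j. *)
Lemma double_point_pair b i j k l (p : V4 R) : bracket_quad b i j k l ->
  #|` fset_set (through b p)|%fset = 2 ->
  [/\ p 0 i != 0, p 0 j != 0 & p 0 i ^+ n = p 0 j ^+ n].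
Proof.
move=> q card2; have := q; case/and4P; rewrite /= !inE !negb_or.
move=> /and4P[/and3P[ij ik il] _ kl _] bij bkl _.
have N0 i' j' : i' != j' -> paired b i' j' -> ~~ ((p 0 i' == 0) && (p 0 j' == 0)).
  move=> ij' bij'; apply/negP => /andP[/eqP pi /eqP pj].
  by have := card_through_ge ij' bij' pi pj; rewrite card2; move: n_gt3; lia.
have [z zn pz] : exists2 z : C, z ^+ n = 1 & p 0 i = z * p 0 j.
  have [//|none] := EM (exists2 z : C, z ^+ n = 1 & p 0 i = z * p 0 j).
  suff : (#|` fset_set (through b p)|%fset <= 1)%N by rewrite card2.
  apply: (@card_fset_set_le_size _ _ [:: coord_plane k l (p 0 k / p 0 l)]).
  move=> L [/(block_quad q)[z zn [->|->]]]; rewrite -memvE mem_coord_plane => /eqP pz.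
    by case: none; exists z.
  rewrite inE; have [l0|l0] := eqVneq (p 0 l) 0.
    by exfalso; move: (N0 k l kl bkl); rewrite pz l0 mulr0 eqxx.
  by rewrite pz mulfK.
have := N0 i j ij bij; rewrite pz mulf_eq0 (negPf (root1_neq0 zn)) /= andbb => pj.
by rewrite exprMn zn mul1r.
Qed.

Variable a : 'I_4 -> C.
Hypothesis HE : forall x : V4 R, (x \in H) = (\sum_i a i * x 0 i == 0).
Hypothesis a_neq0 : forall i, a i != 0.

(** If the sum vanished, so would the complementary one over k, l. Then the planes x_i = (p_i / p_j)
    x_j and x_k = (p_k / p_l) x_l of one block would cut H in the same line, of multiplicity at
    least 2. *)
Lemma light_pair_neq0 i j (p : V4 R) : i != j -> p \in H ->
  (forall h, p 0 h != 0) -> (forall h h', p 0 h ^+ n = p 0 h' ^+ n) ->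
  (forall b l, line n H b l -> line_mult n H b l = 1%N) ->
  a i * p 0 i + a j * p 0 j != 0.
Proof.
move=> ij pH p0 pn lt; apply/eqP => eij.
have [b [k [l q]]] := pair_block_exists ij.
have := q; case/and4P; rewrite /= !inE !negb_or.
move=> /and4P[/and3P[_ ik il] /andP[jk jl] kl _] bij bkl _.
have HqE (x : V4 R) : (x \in H) =
    (a i * x 0 i + a j * x 0 j + (a k * x 0 k + a l * x 0 l) == 0).
  by rewrite HE (sum_bracket_quad _ q) !addrA.
have ekl : a k * p 0 k + a l * p 0 l = 0.
  by move: pH; rewrite HqE eij add0r => /eqP.
have on_plane i' j' : a i' * p 0 i' + a j' * p 0 j' = 0 -> forall x : V4 R,
    (x \in coord_plane i' j' (p 0 i' / p 0 j')) = (a i' * x 0 i' + a j' * x 0 j' == 0).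
  move=> e x; rewrite mem_coord_plane.
  have aj : a j' = - (a i' * (p 0 i' / p 0 j')).
    apply: (mulIf (p0 j')); apply/eqP; rewrite -subr_eq0 -e; apply/eqP.
    by field; exact: p0.
  rewrite aj; set r := p 0 i' / p 0 j'.
  have -> : a i' * x 0 i' + - (a i' * r) * x 0 j' = a i' * (x 0 i' - r * x 0 j') by ring.
  by rewrite mulf_eq0 (negPf (a_neq0 _)) subr_eq0.
pose L1 := coord_plane i j (p 0 i / p 0 j); pose L2 := coord_plane k l (p 0 k / p 0 l).
have rt h h' : (p 0 h / p 0 h') ^+ n = 1.
  by rewrite exprMn exprVn (pn h h') divff // expf_neq0.
have L12 : (L2 :&: H = L1 :&: H)%VS.
  apply/vspaceP => x.
  apply: etrans (memv_cap x L2 H) (etrans _ (esym (memv_cap x L1 H))).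
  apply: etrans (congr1 (andb^~ _) (on_plane k l ekl x)) _.
  apply: etrans _ (esym (congr1 (andb^~ _) (on_plane i j eij x))); rewrite HqE.
  apply/andP/andP => -[/eqP-> xH]; split => //.
    by rewrite addr0 in xH.
  by rewrite add0r in xH.
have L1N : L1 != L2.
  have bk h : basis_vec R k 0 h = (h == k)%:R by rewrite mxE eqxx.
  apply/eqP => /coord_plane_eqP /(_ (basis_vec R k)).
  rewrite !bk (negPf ik) (negPf jk) [l == k]eq_sym (negPf kl) !mulr0 [k == k]eqxx.
  by rewrite oner_eq0 eqxx.
have B1 : block n b L1 by apply: paired_block.
have B2 : block n b L2 by apply: paired_block.
have lin : line n H b (L1 :&: H)%VS by exact: (imageP (fun L => (L :&: H)%VS) B1).
suff : (2 <= line_mult n H b (L1 :&: H)%VS)%N by rewrite lt.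
apply: (@size_le_card_fset_set _ _ [:: L1; L2]).
- by apply: sub_finite_set (finite_block R b n_gt0) => L [].
- by rewrite /= inE L1N.
- by move=> L; rewrite !inE => /orP[]/eqP->; [exact: conj B1 erefl|exact: conj B2 L12].
Qed.

End Geometry.

(** * Counting the points of multiplicity 2 *)

Theorem theorem4p1 (R : realType) (n : nat) (H : {vspace V4 R}) :
  (3 < n)%N -> \dim H = 3%N -> ~ planes n H ->
  light n H -> points_of_mult n H n = set0 ->
  card_less (points_of_mult n H 2) (2 ^ 96)%N.
Proof.
move=> n_gt3 dH _ [_ lm _] no_n; have n_gt0 : (0 < n)%N by exact: leq_trans n_gt3.
have [a HE] := hyperplane_equation dH.
have a0 i : a i != 0.
  apply/eqP => ai; suff : points_of_mult n H n <[basis_vec R i]>%VS by rewrite no_n.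
  apply: basis_point_mult => //; rewrite HE big1 // => h _; rewrite mxE eqxx.
  by have [->|_] := eqVneq h i; rewrite ?ai ?mul0r ?mulr0.
pose i0 := @Ordinal 4 0 isT; pose i1 := @Ordinal 4 1 isT.
pose i2 := @Ordinal 4 2 isT; pose i3 := @Ordinal 4 3 isT.
have q : bracket_quad (@Ordinal 3 0 isT) i0 i1 i2 i3 by [].
have [s ss sP] := covered_unity_sol n_gt0 (a0 i0) (a0 i1) (a0 i2) (a0 i3).
pose pts := [seq <[affine_vec t]>%VS | t <- s].
have sub P : points_of_mult n H 2 P -> P \in pts.
  move=> [[dP PH _] m2]; pose p : V4 R := vpick P.
  have pN0 : p != 0 by rewrite vpick0 -dimv_eq0 dP.
  have PE : P = <[p]>%VS.
    by apply/esym/eqP; rewrite eqEdim -memvE memv_pick dim_vline pN0 dP.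
  have pP i j : i != j -> [/\ p 0 i != 0, p 0 j != 0 & p 0 i ^+ n = p 0 j ^+ n].
    move=> /pair_block_exists[b [k [l qb]]]; apply: (double_point_pair n_gt3 qb).
    by have := m2 b; rewrite PE.
  pose t := (p 0 i1 / p 0 i0, p 0 i2 / p 0 i0, p 0 i3 / p 0 i0).
  have [p0 p1 e1] := pP i0 i1 isT; have [_ p2 e2] := pP i0 i2 isT.
  have [_ p3 e3] := pP i0 i3 isT.
  have tE i : affine_vec t 0 i = p 0 i / p 0 i0.
    rewrite mxE; case: i => [[|[|[|[|//]]]] hi] /=; last 3 first.
    - by congr (p 0 _ / _); apply: val_inj.
    - by congr (p 0 _ / _); apply: val_inj.
    - by congr (p 0 _ / _); apply: val_inj.
    by rewrite -(divff p0); congr (p 0 _ / _); apply: val_inj.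
  have tp : p = p 0 i0 *: affine_vec t.
    by apply/rowP => i; rewrite mxE tE mulrC divfK.
  have tN0 : affine_vec t != 0 by apply: contraNneq pN0 => t0; rewrite tp t0 scaler0.
  have PtE : P = <[affine_vec t]>%VS.
    rewrite PE; apply/eqP; rewrite eqEdim !dim_vline pN0 tN0 leqnn andbT.
    by rewrite -memvE {1}tp memvZ ?memv_line.
  have tH : affine_vec t \in H by rewrite memvE -PtE.
  have t0 h : affine_vec t 0 h != 0.
    rewrite tE mulf_neq0 ?invr_eq0 //.
    by have [->//|h0] := eqVneq h i0; have [] := pP _ _ h0.
  have t1 h : affine_vec t 0 h ^+ n = 1.
    rewrite tE exprMn exprVn; have [->|h0] := eqVneq h i0; first by rewrite divff ?expf_neq0.
    by have [_ _ ->] := pP _ _ h0; rewrite divff ?expf_neq0.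
  (* These are the nondegeneracy conditions; the remaining two-term sums are their opposites. *)
  have tpair h : i0 != h -> a i0 + a h * affine_vec t 0 h != 0.
    move=> h0; have e0 : affine_vec t 0 i0 = 1 by rewrite mxE.
    have := light_pair_neq0 n_gt3 HE a0 h0 tH t0 _ lm.
    by rewrite e0 mulr1; apply => h1 h2; rewrite !t1.
  rewrite PtE; apply: map_f; apply: sP.
  have tn h := norm_unity_root n_gt0 (t1 h).
  have := tpair i1 isT; have := tpair i2 isT; have := tpair i3 isT.
  have := tn i1; have := tn i2; have := tn i3.
  have := t1 i1; have := t1 i2; have := t1 i3.
  move: tH; rewrite HE (sum_bracket_quad _ q) !mxE /= mulr1 => /eqP eH.
  by move=> *; split.
have fin : finite_set (points_of_mult n H 2).
  by apply: (@sub_finite_set _ _ [set` pts]); last exact: finite_seq.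
split=> //; apply: leq_ltn_trans (card_fset_set_le_size sub) _.
(* Here 110 < 2^7. *)
rewrite size_map; apply: leq_ltn_trans ss _; apply: (@leq_trans (2 ^ 7)); first by [].
by rewrite leq_exp2l.
Qed.
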